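(* Let $\Gamma$ be a group in the class $\mathcal C$, and let $1\ne N<G<\Gamma$ be subgroups such that $N$ is normal in $\Gamma$ and $G$ is finitely generated. Then $|\Gamma:G|<\infty$.
   Context: A graph-of-groups decomposition (equivalently, an action without inversions on a tree) is $k$-acylindrical if in the action on the associated Bass–Serre tree, the stabilizer of every geodesic edge-path of length greater than $k$ is trivial; it is acylindrical if it is $k$-acylindrical for some $k$. The class $\mathcal C=\bigcup_{n\ge0}\mathcal C_n$ is defined hierarchically: $\mathcal C_0$ consists of all free products $A\ast B$ of non-trivial finitely presented groups $A,B$ with at least one of $A,B$ of cardinality at least $3$; for $n\ge1$, a group lies in $\mathcal C_n$ if and only if it is the fundamental group of a finite, acylindrical graph of finitely presented groups in which all edge groups are cyclic and at least one vertex group lies in $\mathcal C_{n-1}$. *)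

(* Defs.v *)
From Stdlib Require Import List Arith.
Import ListNotations.
Set Implicit Arguments.

Record group := Group {
  gcar :> Type;
  gmul : gcar -> gcar -> gcar;
  gone : gcar;
  ginv : gcar -> gcar;
  gmulA : forall x y z, gmul x (gmul y z) = gmul (gmul x y) z;
  gmul1l : forall x, gmul gone x = x;
  gmulVl : forall x, gmul (ginv x) x = gone
}.
Arguments gmul {g}. Arguments gone {g}. Arguments ginv {g}.

Section GroupNotions.
Variable G : group.

Definition is_subgroup (P : G -> Prop) : Prop :=
  P gone /\ (forall x y, P x -> P y -> P (gmul x y)) /\ (forall x, P x -> P (ginv x)).

Definition is_normal (P : G -> Prop) : Prop :=
  forall g x, P x -> P (gmul (ginv g) (gmul x g)).

Definition gen (S : G -> Prop) (x : G) : Prop :=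
  forall P, is_subgroup P -> (forall y, S y -> P y) -> P x.

Definition fin_generated (P : G -> Prop) : Prop :=
  exists l : list G, forall x, P x <-> gen (fun y => In y l) x.

Definition finite_index (H : G -> Prop) : Prop :=
  exists reps : list G, forall x, exists r, In r reps /\ H (gmul (ginv r) x).

Definition nontrivial (P : G -> Prop) : Prop := exists x, P x /\ x <> gone.

Definition at_least_three (P : G -> Prop) : Prop :=
  exists x y z, P x /\ P y /\ P z /\ x <> y /\ y <> z /\ x <> z.

Fixpoint gpow (c : G) (n : nat) : G :=
  match n with 0 => gone | S m => gmul c (gpow c m) end.

Definition is_cyclic (P : G -> Prop) : Prop :=
  exists c, P c /\ forall x, P x <-> exists n, x = gpow c n \/ x = gpow (ginv c) n.

End GroupNotions.
Arguments is_subgroup {G}. Arguments is_normal {G}. Arguments gen {G}.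
Arguments fin_generated {G}. Arguments finite_index {G}. Arguments nontrivial {G}.
Arguments at_least_three {G}. Arguments gpow {G}. Arguments is_cyclic {G}.

Definition hom_on {G K : group} (A : G -> Prop) (phi : G -> K) : Prop :=
  forall x y, A x -> A y -> phi (gmul x y) = gmul (phi x) (phi y).

Definition eval_word {K : group} (f : nat -> K) (w : list (nat * bool)) : K :=
  fold_right (fun (p : nat * bool) (acc : gcar K) => gmul (if snd p then f (fst p) else ginv (f (fst p))) acc)
             (@gone K) w.

(** A subgroup A of G is finitely presented: it is generated by g_0..g_{n-1},
    these satisfy the finitely many relators R, and A has the universal property of
    the group <g_0..g_{n-1} | R>. *)
Definition fin_presented {G : group} (A : G -> Prop) : Prop :=
  exists (n : nat) (g : nat -> G) (R : list (list (nat * bool))),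
    (forall x, A x <-> gen (fun y => exists i, i < n /\ y = g i) x) /\
    (forall r, In r R -> forall p, In p r -> fst p < n) /\
    (forall r, In r R -> eval_word g r = gone) /\
    (forall (K : group) (f : nat -> K),
        (forall r, In r R -> eval_word f r = gone) ->
        exists phi : G -> K, hom_on A phi /\ forall i, i < n -> phi (g i) = f i).

Definition free_product_of {G : group} (H A B : G -> Prop) : Prop :=
  is_subgroup A /\ is_subgroup B /\
  (forall x, A x -> H x) /\ (forall x, B x -> H x) /\
  (forall x, H x <-> gen (fun y => A y \/ B y) x) /\
  (forall (K : group) (phiA phiB : G -> K),
      hom_on A phiA -> hom_on B phiB ->
      exists phi : G -> K, hom_on H phi /\
        (forall x, A x -> phi x = phiA x) /\ (forall x, B x -> phi x = phiB x)).

Record tree_action (G : group) (H : G -> Prop) := TreeAction {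
  tV : Type;
  tE : Type;
  torig : tE -> tV;
  tbar : tE -> tE;
  tbar_inv : forall e, tbar (tbar e) = e;
  tbar_nofix : forall e, tbar e <> e;
  actV : G -> tV -> tV;
  actE : G -> tE -> tE;
  actV1 : forall v, actV gone v = v;
  actE1 : forall e, actE gone e = e;
  actVM : forall g h v, H g -> H h -> actV (gmul g h) v = actV g (actV h v);
  actEM : forall g h e, H g -> H h -> actE (gmul g h) e = actE g (actE h e);
  act_orig : forall g e, H g -> torig (actE g e) = actV g (torig e);
  act_bar : forall g e, H g -> tbar (actE g e) = actE g (tbar e);
  act_noinv : forall g e, H g -> actE g e <> tbar e
}.

Section Trees.
Variables (G : group) (H : G -> Prop) (T : tree_action G H).

Definition tterm (e : tE T) : tV T := torig T (tbar T e).

(** edge paths (consecutive edges) and reduced (= geodesic in a tree) edge paths *)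
Fixpoint is_path (l : list (tE T)) : Prop :=
  match l with
  | e1 :: ((e2 :: _) as rest) => tterm e1 = torig T e2 /\ is_path rest
  | _ => True
  end.
Fixpoint is_reduced_path (l : list (tE T)) : Prop :=
  match l with
  | e1 :: ((e2 :: _) as rest) =>
      tterm e1 = torig T e2 /\ e2 <> tbar T e1 /\ is_reduced_path rest
  | _ => True
  end.

Definition path_from_to (l : list (tE T)) (v w : tV T) : Prop :=
  match l with
  | [] => False
  | e :: _ => torig T e = v /\ tterm (last l e) = w
  end.

Definition is_tree : Prop :=
  inhabited (tV T) /\
  (forall v w, v = w \/ exists l, is_path l /\ path_from_to l v w) /\
  (forall l v, is_reduced_path l -> ~ path_from_to l v v).

Definition finite_quotient : Prop :=
  (exists lv : list (tV T), forall v, exists w g, In w lv /\ H g /\ actV T g w = v) /\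
  (exists le : list (tE T), forall e, exists f g, In f le /\ H g /\ actE T g f = e).

Definition vstab (v : tV T) : G -> Prop := fun g => H g /\ actV T g v = v.
Definition estab (e : tE T) : G -> Prop := fun g => H g /\ actE T g e = e.

Definition k_acylindrical (k : nat) : Prop :=
  forall l, is_reduced_path l -> k < length l ->
    forall g, H g -> (forall e, In e l -> actE T g e = e) -> g = gone.

Definition acylindrical : Prop := exists k, k_acylindrical k.
End Trees.

(** * The class C = union of C_n, for subgroups H of an ambient group G
    (the group H itself is meant).  A finite graph of groups decomposition of H
    is encoded, via Bass-Serre theory, by an action of H without inversions on
    a tree with finite quotient graph; vertex/edge groups are the stabilizers. *)
Fixpoint classC_n {G : group} (n : nat) (H : G -> Prop) : Prop :=
  match n with
  | 0 => exists A B : G -> Prop,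
           free_product_of H A B /\ nontrivial A /\ nontrivial B /\
           fin_presented A /\ fin_presented B /\
           (at_least_three A \/ at_least_three B)
  | S m => exists T : tree_action G H,
           is_tree T /\ finite_quotient T /\ acylindrical T /\
           (forall v, fin_presented (vstab T v)) /\
           (forall e, is_cyclic (estab T e)) /\
           exists v, classC_n m (vstab T v)
  end.

Definition in_class_C (G : group) : Prop :=
  exists n, classC_n n (fun _ : G => True).

(* Main.v *)
(** The class is handled by induction on the level, through the following property of a group [V]
    acting on a tree: [V] is infinite and a finitely generated subgroup [H] has finite index as soon
    as it contains a nontrivial normal subgroup of [V], or [V] is a finite union of double cosets
    [H x C] with [C] cyclic.

    Let [X] be the half-tree beyond an edge [e] at the distinguished vertex [w].  For every cyclic [C]
    there is a translate [U] of [X] moved off itself by every nontrivial element of [C]: among three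
    disjoint translates at least one contains no limit behaviour of [C], and acylindricity applies
    deep inside it.  In both cases this [U] forces every translate of [X] and of its complement to
    meet the orbit [H w]: otherwise [H] contains an element moving [w] out of the half-tree to which
    the orbit is confined.  Hence every translate of [e] separates two points of [H w]; as [H] is
    finitely generated, only finitely many edges do so modulo [H], so [V] is a finite union of double
    cosets [H r E] with [E] the cyclic stabilizer of [e].  The conjugates of [H] meet the stabilizer
    of [w] in finitely generated subgroups, for which the property of that stabilizer, applied with
    [C = E], gives finite index; so each [H r E] is a finite union of cosets of [H].

    A free product acts on its Bass-Serre tree with trivial edge stabilizers, where the argument
    stops at [H r E] with [E] trivial. *)

From Stdlib Require Import List Arith Lia Classical ClassicalEpsilon
  FunctionalExtensionality PropExtensionality ProofIrrelevance FinFun.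
Require Import Defs.
Import ListNotations.
Set Implicit Arguments.

Declare Scope grp_scope.
Local Open Scope grp_scope.
Local Notation "x ** y" := (gmul x y) (at level 40, left associativity) : grp_scope.
Local Notation "x ^-1" := (ginv x) (at level 3, format "x ^-1") : grp_scope.

(** * Groups *)

Section GroupLaws.
Variable G : group.
Implicit Types x y z : G.

Lemma gmul_assoc_r x y z : (x ** y) ** z = x ** (y ** z).
Proof. symmetry. apply gmulA. Qed.

Lemma gmulVK x y : x^-1 ** (x ** y) = y.
Proof. now rewrite gmulA, gmulVl, gmul1l. Qed.

Lemma gmul_cancel_l x y z : x ** y = x ** z -> y = z.
Proof. intro E. now rewrite <- (gmulVK x y), E, gmulVK. Qed.

Lemma gmulVr x : x ** x^-1 = gone.
Proof.
  apply gmul_cancel_l with (x := x^-1). rewrite gmulVK.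
  apply gmul_cancel_l with (x := x^-1^-1).
  now rewrite gmulVK, gmulVl.
Qed.

Lemma gmul1r x : x ** gone = x.
Proof. apply gmul_cancel_l with (x := x^-1). now rewrite gmulVK, gmulVl. Qed.

Lemma gmulKV x y : x ** (x^-1 ** y) = y.
Proof. now rewrite gmulA, gmulVr, gmul1l. Qed.

Lemma ginvK x : x^-1^-1 = x.
Proof. apply gmul_cancel_l with (x := x^-1). now rewrite gmulVr, gmulVl. Qed.

Lemma ginv1 : (@gone G)^-1 = gone.
Proof. now rewrite <- (gmul1l _ (gone^-1)), gmulVr. Qed.

Lemma ginvM x y : (x ** y)^-1 = y^-1 ** x^-1.
Proof.
  apply gmul_cancel_l with (x := x ** y).
  now rewrite gmulVr, gmul_assoc_r, gmulKV, gmulVr.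
Qed.

End GroupLaws.

#[local] Hint Rewrite gmul_assoc_r gmulVK gmulKV gmul1l gmul1r gmulVl gmulVr ginvK ginv1 ginvM : grp.
Ltac grp := autorewrite with grp; auto.

(** * Subgroups, powers and cyclic groups *)

Section Subgroups.
Variable G : group.
Implicit Types (x y c r : G) (P Q C : G -> Prop).

Lemma sub1 P : is_subgroup P -> P gone.
Proof. now intros [h _]. Qed.
Lemma subM P x y : is_subgroup P -> P x -> P y -> P (x ** y).
Proof. intros [_ [h _]]; auto. Qed.
Lemma subV P x : is_subgroup P -> P x -> P x^-1.
Proof. intros [_ [_ h]]; auto. Qed.

Lemma gpow_sub P x n : is_subgroup P -> P x -> P (gpow x n).
Proof. intros hP hx. induction n; simpl; [now apply sub1 | now apply subM]. Qed.

Lemma gpowD x m n : gpow x (m + n) = gpow x m ** gpow x n.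
Proof. induction m; simpl; grp. now rewrite IHm. Qed.

Lemma gpow1 x : gpow x 1 = x.
Proof. simpl. grp. Qed.

Lemma gpowM x m n : gpow x (m * n) = gpow (gpow x m) n.
Proof.
  rewrite Nat.mul_comm. induction n; simpl; auto. now rewrite gpowD, IHn.
Qed.

Lemma gpowSr x n : gpow x (S n) = gpow x n ** x.
Proof. rewrite <- Nat.add_1_r, gpowD, gpow1. reflexivity. Qed.

Lemma gpowV x n : gpow x^-1 n = (gpow x n)^-1.
Proof.
  induction n; [simpl; grp|]. rewrite gpowSr, IHn. simpl. grp.
Qed.

Lemma gen_sub (S : G -> Prop) : is_subgroup (gen S).
Proof.
  split; [|split].
  - intros P hP _. now apply sub1.
  - intros x y hx hy P hP hS. apply subM; [auto|apply hx|apply hy]; auto.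
  - intros x hx P hP hS. apply subV; [auto|]. apply hx; auto.
Qed.

Lemma gen_in (S : G -> Prop) x : S x -> gen S x.
Proof. intros h P _ hS. auto. Qed.

Lemma gen_mono (S S' : G -> Prop) x : (forall y, S y -> S' y) -> gen S x -> gen S' x.
Proof. intros h hx. apply hx; [apply gen_sub|]. intros y hy. apply gen_in; auto. Qed.

Lemma fin_generated_sub P : fin_generated P -> is_subgroup P.
Proof.
  intros [l hl]. destruct (gen_sub (fun y => In y l)) as [h1 [h2 h3]].
  repeat split.
  - now apply hl.
  - intros x y hx hy. apply hl. apply h2; now apply hl.
  - intros x hx. apply hl, h3. now apply hl.
Qed.

Lemma subI P Q : is_subgroup P -> is_subgroup Q -> is_subgroup (fun x => P x /\ Q x).
Proof.
  intros hP hQ. split; [|split].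
  - split; now apply sub1.
  - intros x y [] []. split; now apply subM.
  - intros x []. split; now apply subV.
Qed.

Lemma sub_trivial : is_subgroup (fun x : G => x = gone).
Proof.
  repeat split; [intros x y -> ->; grp | intros x ->; grp].
Qed.

Definition cyc (c x : G) : Prop := exists n, x = gpow c n \/ x = gpow c^-1 n.

Lemma cyc_sub c : is_subgroup (cyc c).
Proof.
  assert (hM : forall (d : G) m n, cyc d (gpow d m ** gpow d^-1 n)).
  { intros d m n. destruct (le_lt_dec n m) as [h|h].
    - exists (m - n). left. replace m with (m - n + n) at 1 by lia.
      rewrite gpowD, gpowV. grp.
    - exists (n - m). right. replace n with (m + (n - m)) at 1 by lia.
      rewrite gpowD, !gpowV. grp. }
  assert (hI : forall d x : G, cyc d^-1 x -> cyc d x).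
  { intros d x [n [->| ->]]; exists n; auto. rewrite ginvK. auto. }
  split; [|split].
  - exists 0. now left.
  - intros x y [m [->| ->]] [n [->| ->]]; auto.
    + exists (m + n). left. now rewrite gpowD.
    + apply hI. specialize (hM c^-1 m n). now rewrite ginvK in hM.
    + exists (m + n). right. now rewrite gpowD.
  - intros x [n [->| ->]]; exists n.
    + right. now rewrite gpowV.
    + left. rewrite gpowV. grp.
Qed.

Lemma cyc_self c : cyc c c.
Proof. exists 1. left. now rewrite gpow1. Qed.

Lemma cyc_cyclic c : is_cyclic (cyc c).
Proof. exists c. split; [apply cyc_self|]. now intros x. Qed.

Lemma gpow_comm c m n : gpow c m ** gpow c n = gpow c n ** gpow c m.
Proof. rewrite <- !gpowD. f_equal. lia. Qed.

Lemma comm_inv (x y : G) : x ** y = y ** x -> x ** y^-1 = y^-1 ** x.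
Proof.
  intro E. apply gmul_cancel_l with (x := y). grp.
  rewrite gmulA, <- E. grp.
Qed.

Lemma cyclic_comm C x y : is_cyclic C -> C x -> C y -> x ** y = y ** x.
Proof.
  intros [c [_ h]] hx hy. apply h in hx as [m hm], hy as [n hn].
  assert (E := gpow_comm c m n).
  rewrite !gpowV in hm, hn.
  destruct hm as [->| ->], hn as [->| ->]; auto.
  - now apply comm_inv.
  - symmetry. now apply comm_inv.
  - rewrite <- !ginvM. now f_equal.
Qed.

(** The least positive exponent [m] with [gpow c m] in [D] gives a generator, by division with
    remainder; without such an exponent [D] is trivial. *)
Lemma cyclic_subgroup_fg C D : is_cyclic C -> is_subgroup D ->
  (forall x, D x -> C x) -> fin_generated D.
Proof.
  intros [c [_ hC]] hD hDC.
  assert (hDp : forall x, D x -> exists n, D (gpow c n) /\ (x = gpow c n \/ x = (gpow c n)^-1)).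
  { intros x hx. destruct (proj1 (hC x) (hDC _ hx)) as [n [->| ->]]; exists n; [tauto|].
    rewrite gpowV in *. split; [|tauto]. rewrite <- (ginvK _ (gpow c n)). now apply subV. }
  destruct (classic (exists n, 0 < n /\ D (gpow c n))) as [[n hn]|hno].
  - destruct (dec_inh_nat_subset_has_unique_least_element
      (fun n => 0 < n /\ D (gpow c n))) as [m [[[hm0 hm] hmin] _]].
    { intro j. apply classic. }
    { eauto. }
    exists [gpow c m]. intro x. split.
    + intro hx. apply hDp in hx as [j [hj hxj]].
      assert (gen (fun y => In y [gpow c m]) (gpow c j)).
      { rewrite (Nat.div_mod_eq j m) in hj |- *.
        rewrite gpowD, gpowM in hj |- *.
        assert (hq : D (gpow (gpow c m) (j / m))) by now apply gpow_sub.
        assert (hr : D (gpow c (j mod m))).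
        { rewrite <- (gmulVK _ (gpow (gpow c m) (j / m))). apply subM; auto. now apply subV. }
        assert (hz : j mod m = 0).
        { assert (j mod m < m) by (apply Nat.mod_upper_bound; lia).
          destruct (Nat.eq_dec (j mod m) 0); auto.
          assert (m <= j mod m) by (apply hmin; split; auto; lia). lia. }
        rewrite hz. replace (gpow c 0) with (@gone G) by auto. rewrite gmul1r.
        apply (gpow_sub (P := gen (fun y => In y [gpow c m]))); [apply gen_sub|]. apply gen_in. now left. }
      destruct hxj as [->| ->]; auto. apply subV; auto. apply gen_sub.
    + intro hx. apply hx; auto. intros y [<-|[]]. auto.
  - exists []. intro x. split.
    + intro hx. apply hDp in hx as [j [hj hxj]]. destruct j.
      * simpl in hxj. rewrite ginv1 in hxj. destruct hxj as [->| ->]; apply sub1, gen_sub.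
      * exfalso. apply hno. exists (S j). split; auto. lia.
    + intro hx. apply hx; auto. now intros y [].
Qed.

Lemma fin_generated_conj P r : fin_generated P -> fin_generated (fun x => P (r ** x ** r^-1)).
Proof.
  intros [l hl]. exists (map (fun y => r^-1 ** y ** r) l). intro x.
  set (Q := gen (fun y => In y (map (fun y => r^-1 ** y ** r) l))).
  assert (hQ : is_subgroup Q) by apply gen_sub. split.
  - intro hx. apply hl in hx.
    replace x with (r^-1 ** (r ** x ** r^-1) ** r) by grp.
    apply (hx (fun z => Q (r^-1 ** z ** r))).
    + split; [|split].
      * replace (r^-1 ** gone ** r) with (@gone G) by grp. now apply sub1.
      * intros a b ha hb.
        replace (r^-1 ** (a ** b) ** r) with ((r^-1 ** a ** r) ** (r^-1 ** b ** r)) by grp.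
        now apply subM.
      * intros a ha. replace (r^-1 ** a^-1 ** r) with ((r^-1 ** a ** r)^-1) by grp.
        now apply subV.
    + intros y hy. apply gen_in. apply in_map_iff. eauto.
  - assert (hP : is_subgroup P) by (apply fin_generated_sub; now exists l).
    intro hx. apply (hx (fun x => P (r ** x ** r^-1))).
    + split; [|split].
      * replace (r ** gone ** r^-1) with (@gone G) by grp. now apply sub1.
      * intros a b ha hb.
        replace (r ** (a ** b) ** r^-1) with ((r ** a ** r^-1) ** (r ** b ** r^-1)) by grp.
        now apply subM.
      * intros a ha. replace (r ** a^-1 ** r^-1) with ((r ** a ** r^-1)^-1) by grp.
        now apply subV.
    + intros y hy. apply in_map_iff in hy as [z [<- hz]].
      replace (r ** (r^-1 ** z ** r) ** r^-1) with z by grp.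
      apply hl. now apply gen_in.
Qed.

End Subgroups.

(** * Finite choice and the pigeonhole principle *)

Lemma list_choice (A B : Type) (R : A -> B -> Prop) (l : list A) :
  exists l' : list B, (forall b, In b l' -> exists a, In a l /\ R a b) /\
    forall a, In a l -> (exists b, R a b) -> exists b, In b l' /\ R a b.
Proof.
  induction l as [|a l [l' [h1 h2]]].
  - exists []. split; [now intros b []|now intros a []].
  - destruct (classic (exists b, R a b)) as [[b hb]|hn].
    + exists (b :: l'). split.
      * intros b' [<-|h]; [exists a; split; auto; now left|].
        apply h1 in h as [a' [? ?]]. exists a'. split; auto. now right.
      * intros a' [<-|h] hex; [exists b; split; auto; now left|].
        destruct (h2 _ h hex) as [b' []]. exists b'. split; auto. now right.
    + exists l'. split.
      * intros b h. apply h1 in h as [a' [? ?]]. exists a'. split; auto. now right.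
      * intros a' [<-|h] hex; [easy|auto].
Qed.

Lemma pigeonhole (A : Type) (l : list A) : forall R : nat -> A -> Prop,
  (forall n, exists a, In a l /\ R n a) -> exists m n a, m < n /\ R m a /\ R n a.
Proof.
  induction l as [|a l IH]; intros R h.
  - destruct (h 0) as [a [[] _]].
  - destruct (classic (exists m, R m a)) as [[m hm]|hn].
    + destruct (classic (exists n, m < n /\ R n a)) as [[n [hmn hn]]|hn].
      * exists m, n, a. auto.
      * destruct (IH (fun n => R (S m + n))) as [p [q [b [? []]]]].
        { intro n. destruct (h (S m + n)) as [b [[<-|hb] hR]]; [|eauto].
          exfalso. apply hn. exists (S m + n). split; auto. lia. }
        exists (S m + p), (S m + q), b. repeat split; auto. lia.
    + apply IH. intro n. destruct (h n) as [b [[<-|hb] hR]]; [|eauto].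
      exfalso. eauto.
Qed.

(** * Half-trees *)

Section TreeGeometry.
Variables (G : group) (V : G -> Prop) (T : tree_action G V).
Hypothesis hV : is_subgroup V.

Local Notation o := (torig T).
Local Notation t := (tterm T).
Local Notation bar := (tbar T).
Local Notation av := (actV T).
Local Notation ae := (actE T).
Implicit Types (x y z g h : G) (a b e f : tE T) (p q u v w : tV T).

Lemma term_bar a : t (bar a) = o a.
Proof. unfold tterm. now rewrite tbar_inv. Qed.

Lemma av_invK g v : V g -> av g^-1 (av g v) = v.
Proof. intro hg. rewrite <- actVM, gmulVl, actV1; auto. now apply subV. Qed.
Lemma av_Kinv g v : V g -> av g (av g^-1 v) = v.
Proof. intro hg. rewrite <- actVM, gmulVr, actV1; auto. now apply subV. Qed.
Lemma ae_invK g e : V g -> ae g^-1 (ae g e) = e.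
Proof. intro hg. rewrite <- actEM, gmulVl, actE1; auto. now apply subV. Qed.
Lemma ae_Kinv g e : V g -> ae g (ae g^-1 e) = e.
Proof. intro hg. rewrite <- actEM, gmulVr, actE1; auto. now apply subV. Qed.

Lemma ae_inj g a b : V g -> ae g a = ae g b -> a = b.
Proof. intros hg E. now rewrite <- (ae_invK a hg), E, ae_invK. Qed.

Lemma act_term g e : V g -> t (ae g e) = av g (t e).
Proof. intro hg. unfold tterm. now rewrite act_bar, act_orig. Qed.

Lemma vstab_sub w : is_subgroup (vstab T w).
Proof.
  split; [|split].
  - split; [now apply sub1 | apply actV1].
  - intros x y [hx ex] [hy ey]. split; [now apply subM|]. rewrite actVM; congruence.
  - intros x [hx ex]. split; [now apply subV|]. now rewrite <- ex at 1; apply av_invK.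
Qed.

Lemma estab_sub e : is_subgroup (estab T e).
Proof.
  split; [|split].
  - split; [now apply sub1 | apply actE1].
  - intros x y [hx ex] [hy ey]. split; [now apply subM|]. rewrite actEM; congruence.
  - intros x [hx ex]. split; [now apply subV|]. now rewrite <- ex at 1; apply ae_invK.
Qed.

Lemma estab_vstab e x : estab T e x -> vstab T (o e) x.
Proof. intros [hx ex]. split; auto. rewrite <- act_orig, ex; auto. Qed.

(** Walks as an inductive relation spare list bookkeeping; [conn_reduced] turns them into reduced
    paths where the tree axioms are needed. *)
Inductive conn (Q : tE T -> Prop) : tV T -> tV T -> Prop :=
| conn_refl v : conn Q v v
| conn_step a v : Q a -> conn Q (t a) v -> conn Q (o a) v.

Lemma conn_trans Q u v w : conn Q u v -> conn Q v w -> conn Q u w.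
Proof. induction 1; auto. intro. apply conn_step; auto. Qed.

Lemma conn_edge (Q : tE T -> Prop) a : Q a -> conn Q (o a) (t a).
Proof. intro h. apply conn_step; [auto|apply conn_refl]. Qed.

Lemma conn_sym (Q : tE T -> Prop) u v : (forall a, Q a -> Q (bar a)) -> conn Q u v -> conn Q v u.
Proof.
  intro hQ. induction 1 as [v|a v hq _ IH]; [apply conn_refl|].
  apply (conn_trans IH). rewrite <- (term_bar a). apply (@conn_edge Q (bar a)). auto.
Qed.

Lemma last_cons (A : Type) (a b : A) l : last (a :: l) b = last l a.
Proof. revert a. induction l as [|c l IH]; intro a; auto. simpl in *. destruct l; auto. Qed.

(** A new first edge is either put in front of the reduced path or cancelled against the inverse
    edge with which that path begins. *)
Lemma conn_reduced Q u v : conn Q u v ->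
  u = v \/ exists l, is_reduced_path T l /\ path_from_to T l u v /\ forall a, In a l -> Q a.
Proof.
  induction 1 as [v|a v hq _ IH]; [auto|].
  destruct IH as [<-|[l [hr [hp hQ]]]].
  - right. exists [a]. simpl. repeat split; auto. intros b [<-|[]]; auto.
  - destruct l as [|b l]; [destruct hp|]. destruct hp as [hb hl].
    destruct (classic (b = bar a)) as [->|hne].
    + destruct l as [|c l].
      * left. simpl in hl. now rewrite <- hl, term_bar.
      * right. exists (c :: l). destruct hr as [h1 [h2 h3]].
        repeat split; auto.
        -- now rewrite <- h1, term_bar.
        -- now rewrite !last_cons in *.
        -- intros d hd. apply hQ. now right.
    + right. exists (a :: b :: l). repeat split; auto.
      * now rewrite !last_cons in *.
      * intros d [<-|hd]; auto.
Qed.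

Definition avoids e a : Prop := a <> e /\ a <> bar e.

Lemma avoids_bar e a : avoids e a -> avoids e (bar a).
Proof.
  intros [h1 h2]. split; intro E.
  - apply h2. now rewrite <- E, tbar_inv.
  - apply h1. now rewrite <- (tbar_inv T a), E, tbar_inv.
Qed.

Lemma avoids_bar_l e a : avoids e a -> avoids (bar e) a.
Proof. intros [h1 h2]. split; auto. now rewrite tbar_inv. Qed.

(** The component of [t e] in the tree minus the open edge [e]. *)
Definition half e v : Prop := conn (avoids e) (t e) v.

Lemma half_term e : half e (t e).
Proof. apply conn_refl. Qed.

Lemma half_bar_orig e : half (bar e) (o e).
Proof. rewrite <- term_bar. apply half_term. Qed.

Lemma half_edge e a : avoids e a -> (half e (o a) <-> half e (t a)).
Proof.
  intro h. split; intro h'; apply (conn_trans h').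
  - now apply conn_edge.
  - rewrite <- (term_bar a). apply (conn_edge (avoids e) (bar a)). now apply avoids_bar.
Qed.

Lemma conn_act (Q Q' : tE T -> Prop) g u v : V g ->
  (forall a, Q a -> Q' (ae g a)) -> conn Q u v -> conn Q' (av g u) (av g v).
Proof.
  intros hg hQ. induction 1 as [v|a v hq _ IH]; [apply conn_refl|].
  rewrite <- act_orig by auto. apply conn_step; auto. now rewrite act_term.
Qed.

Lemma half_act_imp g e v : V g -> half e v -> half (ae g e) (av g v).
Proof.
  intros hg h. unfold half. rewrite act_term by auto.
  refine (conn_act _ hg _ h). intros a [h1 h2]. split; intro E.
  - apply h1. now apply ae_inj in E.
  - apply h2. rewrite act_bar in E by auto. now apply ae_inj in E.
Qed.

Lemma half_act g e v : V g -> (half (ae g e) (av g v) <-> half e v).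
Proof.
  intro hg. split; [|now apply half_act_imp]. intro h.
  apply (@half_act_imp g^-1) in h; [|now apply subV].
  now rewrite ae_invK, av_invK in h.
Qed.

Lemma half_act_l g e v : V g -> (half (ae g e) v <-> half e (av g^-1 v)).
Proof. intro hg. now rewrite <- (half_act e (av g^-1 v) hg), av_Kinv. Qed.

Hypothesis hT : is_tree T.

Lemma loop_free a : o a <> t a.
Proof.
  intro E. destruct hT as [_ [_ h]]. apply (h [a] (o a)); simpl; auto.
Qed.

Lemma tree_conn u v : conn (fun _ => True) u v.
Proof.
  destruct hT as [_ [h _]]. destruct (h u v) as [->|[l [hl hp]]]; [apply conn_refl|].
  destruct l as [|a l]; [destruct hp|].
  revert a u hl hp. induction l as [|b l IH]; intros a u hl [ho he].
  - subst u. rewrite <- he. now apply conn_edge.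
  - subst u. apply conn_step; auto. destruct hl as [h1 h2].
    apply (IH b); auto. split; auto.
    now rewrite !last_cons in *.
Qed.

(** A vertex on both sides of [e] would give a walk from [t e] to [o e] avoiding [e]; its reduction,
    closed up by [e], is a reduced loop. Every vertex lies on some side because only [e] and [bar e]
    lead from one side to the other. *)
Lemma half_bar e v : half (bar e) v <-> ~ half e v.
Proof.
  split.
  - intros h1 h2.
    assert (h3 : conn (avoids e) (t e) (o e)).
    { apply (conn_trans h2). apply conn_sym; [apply avoids_bar|].
      unfold half in h1. rewrite term_bar in h1.
      clear - h1. induction h1 as [|a v hq _ IH]; [apply conn_refl|]. apply conn_step; auto.
      apply avoids_bar_l in hq. now rewrite tbar_inv in hq. }
    apply conn_reduced in h3 as [E|[l [hr [hp hQ]]]].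
    + now apply (loop_free e).
    + destruct hT as [_ [_ hno]]. destruct l as [|b l]; [destruct hp|]. destruct hp as [hb hl].
      apply (hno (e :: b :: l) (o e)).
      * simpl in hr |- *. repeat split; auto. apply (hQ b). now left.
      * split; auto. now rewrite !last_cons in *.
  - intro hn. destruct (classic (half (bar e) v)) as [h|hn']; auto. exfalso.
    assert (H : forall u, conn (fun _ => True) u v -> half e u \/ half (bar e) u ->
                half e v \/ half (bar e) v).
    { induction 1 as [|a v _ _ IH]; auto. intro h. apply IH; auto.
      destruct (classic (a = e)) as [->|h1]; [left; apply half_term|].
      destruct (classic (a = bar e)) as [->|h2]; [right; apply half_term|].
      assert (hv : avoids e a) by (split; auto).
      rewrite (half_edge hv), (half_edge (avoids_bar_l hv)) in h. auto. }
    destruct (H (t e) (tree_conn _ _) (or_introl (half_term e))); auto.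
Qed.

Lemma half_orig e : ~ half e (o e).
Proof. apply half_bar, half_bar_orig. Qed.

(** A walk inside [half f] can leave [half e] only through [bar e], which ends at [o e], outside
    [half f]. *)
Lemma half_nest e f v : avoids e f -> half e (t f) -> ~ half f (o e) -> half f v -> half e v.
Proof.
  intros hef he hf hv. unfold half in hv.
  assert (hfe : avoids f e).
  { destruct hef as [h1 h2]. split; intro E; [auto|]. apply h2. now rewrite E, tbar_inv. }
  assert (H : forall u, conn (avoids f) u v -> half f u -> half e u -> half e v).
  { induction 1 as [|a v hq _ IH]; auto. intros h1 h2.
    rewrite (half_edge hq) in h1. apply IH; auto.
    destruct (classic (a = e)) as [->|h3]; [apply half_term|].
    destruct (classic (a = bar e)) as [->|h4].
    - exfalso. apply hf. now rewrite term_bar in h1.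
    - exact (proj1 (half_edge (conj h3 h4 : avoids e a)) h2). }
  apply (H (t f)); auto. apply half_term.
Qed.

(** The four relative positions are told apart by whether [t f] lies in [half e] and whether [o e]
    lies in [half f]. *)
Lemma half_cases e f : f <> bar e -> f <> e ->
  (forall v, half f v -> half e v) \/ (forall v, half e v -> half f v) \/
  (forall v, half e v -> half f v -> False) \/ (forall v, ~ half f v -> half e v).
Proof.
  intros h1 h2.
  assert (hef : avoids e f) by (split; auto).
  assert (hfe : avoids f e).
  { split; auto. intro E. apply h1. now rewrite E, tbar_inv. }
  destruct (classic (half e (t f))) as [he|he]; destruct (classic (half f (o e))) as [hf|hf].
  - right. right. right. intros v hv. apply half_bar in hv.
    apply (@half_nest e (bar f)); auto.
    + now apply avoids_bar.
    + rewrite term_bar. now apply half_edge.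
    + intro h. now apply half_bar in h.
  - left. intro v. now apply half_nest.
  - right. left. intros v hv. apply NNPP. intro hn. apply half_bar in hn.
    revert hv. apply half_bar.
    apply (@half_nest (bar e) (bar f)); auto.
    + now apply avoids_bar_l, avoids_bar.
    + rewrite term_bar. apply half_bar. now rewrite (half_edge hef).
    + intro h. apply half_bar in h. apply h. now apply (half_edge hfe).
  - right. right. left. intros v hv hv'. revert hv. apply half_bar.
    apply (@half_nest (bar e) f); auto.
    + now apply avoids_bar_l.
    + now apply half_bar.
    + intro h. apply hf. now apply (half_edge hfe).
Qed.

Lemma half_eq a b : (forall v, half a v <-> half b v) -> a = b.
Proof.
  intro h. apply NNPP. intro hne.
  assert (hv : avoids b a).
  { split; auto. intros ->. destruct (proj1 (half_bar b (t b))); [|apply half_term].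
    apply h, half_term. }
  apply (@half_orig a). apply h. apply (half_edge hv). apply h, half_term.
Qed.

Lemma half_disjoint a b v : o a = o b -> a <> b -> half a v -> half b v -> False.
Proof.
  intros hab hne ha hb.
  assert (hv : avoids a b).
  { split; auto. intros ->. apply (loop_free (bar a)). now rewrite term_bar. }
  revert ha. apply half_bar. apply (@half_nest (bar a) b); auto.
  - now apply avoids_bar_l.
  - apply half_bar. rewrite <- (half_edge hv), <- hab. apply half_orig.
  - change (o (bar a)) with (t a). rewrite <- half_edge, hab; [apply half_orig|].
    destruct hv as [h1 h2]. split; auto. intro E. apply h2. now rewrite E, tbar_inv.
Qed.

(** Up to orientation, all such edges occur on any one walk from [p] to [q]. *)
Lemma separating_edges_finite p q : exists l, forall a, half a p -> ~ half a q -> In a l.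
Proof.
  induction (tree_conn p q) as [v|a v _ _ [l hl]].
  - exists []. tauto.
  - exists (a :: bar a :: l). intros b h1 h2.
    destruct (classic (b = a)) as [->|n1]; [now left|].
    destruct (classic (b = bar a)) as [->|n2]; [right; now left|].
    right. right. apply hl; auto. apply (half_edge (e := b) (a := a)); auto.
    split; auto. intros ->. apply n2. now rewrite tbar_inv.
Qed.

(** Half-trees shrink along a reduced path, by [half_nest]. *)
Lemma reduced_half a l b : is_reduced_path T (a :: l) -> In b (a :: l) ->
  (forall v, half b v -> half a v) /\
  forall v, half (last l a) v -> half b v.
Proof.
  revert a b. induction l as [|c l IH]; intros a b hr hb.
  - destruct hb as [<-|[]]. auto.
  - destruct hr as [h1 [h2 h3]].
    assert (hv : avoids a c).
    { split; auto. intros ->. now apply (loop_free a). }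
    assert (hca : forall v, half c v -> half a v).
    { intro v. apply half_nest; auto.
      - rewrite <- half_edge, <- h1; auto. apply half_term.
      - rewrite half_edge, h1; [apply half_orig|].
        destruct hv as [h4 h5]. split; auto. intro E. apply h5. now rewrite E, tbar_inv. }
    rewrite last_cons. destruct hb as [<-|hb].
    + split; auto. intros v hv'. apply hca. eapply (IH c c); eauto. now left.
    + destruct (IH c b h3 hb). split; auto.
Qed.

Lemma reduced_path_exists p q : p <> q ->
  exists a l, is_reduced_path T (a :: l) /\ o a = p /\ t (last l a) = q.
Proof.
  intro hne. destruct (conn_reduced (tree_conn p q)) as [|[l [h1 [h2 _]]]]; [easy|].
  destruct l as [|a l]; [destruct h2|]. exists a, l. destruct h2 as [h2 h3].
  rewrite last_cons in h3. auto.
Qed.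

Lemma first_edge p q : p <> q -> exists a, o a = p /\ half a q.
Proof.
  intro hne. destruct (reduced_path_exists hne) as [a [l [h1 [h2 h3]]]].
  exists a. split; auto. apply (@reduced_half a l a); auto; [now left|].
  apply (@reduced_half a l (last l a)); auto.
  - destruct l as [|b l]; [now left|]. right. rewrite last_cons.
    destruct (exists_last (l := b :: l)) as [l' [c E]]; [easy|].
    rewrite <- (last_cons b a), E, last_last. apply in_or_app. right. now left.
  - rewrite <- h3. apply half_term.
Qed.

End TreeGeometry.

(** * Finitely generated groups acting on trees *)

Section FinitelyGeneratedActions.
Variables (G : group) (V : G -> Prop) (T : tree_action G V).
Hypothesis hV : is_subgroup V.
Hypothesis hT : is_tree T.
Variables (H : G -> Prop) (F : list G) (w : tV T).
Hypothesis hHV : forall x, H x -> V x.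
Hypothesis hF : forall x, H x <-> gen (fun y => In y F) x.

Local Notation o := (torig T).
Local Notation av := (actV T).
Local Notation ae := (actE T).

Lemma orbit_group : is_subgroup H.
Proof. apply fin_generated_sub. now exists F. Qed.

Lemma generator_in f : In f F -> H f.
Proof. intro h. apply hF. now apply gen_in. Qed.

Lemma generator_separating_edges : exists P, forall f a, In f F ->
  ~ (half T a w <-> half T a (av f w)) -> In a P.
Proof.
  destruct (@list_choice G (list (tE T))
    (fun f l => forall a, ~ (half T a w <-> half T a (av f w)) -> In a l) F)
    as [L [_ hL]].
  exists (concat L). intros f a hf ha.
  destruct (hL f hf) as [l [hl1 hl2]].
  - destruct (separating_edges_finite hT w (av f w)) as [l1 h1].
    destruct (separating_edges_finite hT (av f w) w) as [l2 h2].
    exists (l1 ++ l2). intros b hb. apply in_or_app.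
    destruct (classic (half T b w)); destruct (classic (half T b (av f w))); try tauto; auto.
  - apply in_concat. eauto.
Qed.

(** When [x1^-1 ** x2] is written as a word in the generators, some step from [z w] to [z f w]
    crosses [a]; the translate of [a] by [z^-1] is then in [P]. *)
Lemma orbit_separating_edge P a x1 x2 :
  (forall f a, In f F -> ~ (half T a w <-> half T a (av f w)) -> In a P) ->
  H x1 -> H x2 -> half T a (av x1 w) -> ~ half T a (av x2 w) ->
  exists z, H z /\ In (ae z a) P.
Proof.
  intros hP h1 h2 ha1 ha2. apply NNPP. intro hno.
  assert (hH := orbit_group).
  (* The elements whose right multiplication never changes the side of [a] form a subgroup; if no
     translate of [a] is in [P], it contains the generators. *)
  assert (hQ : forall x, H x ->
    H x /\ forall z, H z -> (half T a (av z w) <-> half T a (av (z ** x) w))).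
  { intros x hx. apply hF in hx. pattern x. apply hx.
    - split; [|split].
      + split; [now apply sub1|]. intros z _. now rewrite gmul1r.
      + intros x' y [hx' ex] [hy ey]. split; [now apply subM|]. intros z hz.
        rewrite ex, ey by (auto; now apply subM). now rewrite gmulA.
      + intros y [hy ey]. split; [now apply subV|]. intros z hz.
        rewrite (ey (z ** y^-1)) by (apply subM; auto; now apply subV). now grp.
    - intros f hf. assert (hHf := generator_in _ hf). split; auto. intros z hz.
      apply NNPP. intro hsep. apply hno. exists z^-1. split; [now apply subV|].
      apply (hP f); auto.
      rewrite !half_act_l by (auto; apply hHV; now apply subV).
      rewrite ginvK. intro h. apply hsep. rewrite actVM; auto. }
  assert (h21 : H (x1^-1 ** x2)) by (apply subM; auto; now apply subV).
  apply ha2. rewrite <- (gmulKV _ x1 x2). now apply (proj2 (hQ _ h21) x1 h1).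
Qed.

(** To each [x] in [H] belongs, according to the direction in which [x w] is seen from [w], an
    element [y] of the stabilizer. A finitely generated [L] is built so that the coset [y L] does
    not change when [x] is multiplied by a generator. Finite generation of the edge stabilizers
    absorbs the ambiguity of [y]. *)
Lemma vstab_fin_generated :
  (forall e, fin_generated (fun x => H x /\ estab T e x)) ->
  fin_generated (fun x => H x /\ vstab T w x).
Proof.
  intro hE.
  assert (hH := orbit_group).
  pose (S := fun x => H x /\ vstab T w x).
  assert (hS : is_subgroup S) by (apply subI; auto; now apply vstab_sub).
  assert (hSw : forall y, S y -> av y w = w) by now intros y [_ [_ h]].
  assert (hSV : forall y, S y -> V y) by (intros y [h _]; auto).
  destruct generator_separating_edges as [P hP].
  (* [R] holds one edge at [w] for each edge of [P] that is an [H]-translate of an edge at [w]. *)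
  destruct (list_choice (fun p a => o a = w /\ exists z, H z /\ ae z a = p) P) as [R [hR1 hR2]].
  assert (hRo : forall r, In r R -> o r = w) by (intros r hr; now destruct (hR1 r hr) as [p [_ []]]).
  (* [K x y]: the first edge of the geodesic from [w] to [x w] is the [y]-translate of an edge of [R]. *)
  pose (K := fun x y => S y /\ ((S x /\ y = x) \/
     (av x w <> w /\ exists r, In r R /\ half T (ae y r) (av x w)))).
  assert (hKex : forall x, H x -> exists y, K x y).
  { intros x hx. destruct (classic (av x w = w)) as [hw|hw].
    - assert (S x) by (repeat split; auto). exists x. split; auto.
    - destruct (first_edge hT (p := w) (q := av x w)) as [a [ha1 ha2]]; auto.
      destruct (@orbit_separating_edge P a x gone) as [z [hz hza]]; auto.
      { now apply sub1. }
      { rewrite actV1, <- ha1. now apply half_orig. }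
      destruct (hR2 _ hza) as [r [hr [hro [z' [hz' e]]]]]; [eauto|].
      assert (E : ae (z^-1 ** z') r = a).
      { rewrite actEM, e by (auto; apply hHV; now apply subV). now apply ae_invK; auto. }
      assert (hz'' : H (z^-1 ** z')) by (apply subM; auto; now apply subV).
      exists (z^-1 ** z'). split.
      + repeat split; auto. rewrite <- hro at 1. rewrite <- act_orig, E by auto. auto.
      + right. split; auto. exists r. now rewrite E. }
  (* A step from [z] to [z ** f] is exceptional if [z] lies in [S z0] for some [z0] in [Z ++ Z'].
     This covers the steps that start or end in [S] and those crossing the first edge towards [z w].
     Up to [S] there are finitely many, and [L3] records their effect. *)
  pose (Z := gone :: map ginv F).
  destruct (list_choice (fun p x => H x /\ o (ae x p) = w) P) as [Z' [hZ1 hZ2]].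
  destruct (list_choice (fun r l => forall x, (H x /\ estab T r x) <-> gen (fun y => In y l) x) R)
    as [L1 [hL11 hL12]].
  destruct (list_choice (fun rr h => S h /\ ae h (snd rr) = fst rr) (list_prod R R))
    as [L2 [hL21 hL22]].
  destruct (list_choice (fun zf g => exists y y', K (fst zf) y /\ K (fst zf ** snd zf) y' /\ g = y^-1 ** y')
    (list_prod (Z ++ Z') F)) as [L3 [hL31 hL32]].
  pose (L := gen (fun y => In y (concat L1 ++ L2 ++ L3))).
  assert (hL : is_subgroup L) by apply gen_sub.
  assert (hZH : forall z, In z (Z ++ Z') -> H z).
  { intros z hz. apply in_app_or in hz as [[<-|hz]|hz].
    - now apply sub1.
    - apply in_map_iff in hz as [f [<- hf]]. apply subV; auto. now apply generator_in.
    - now destruct (hZ1 z hz) as [p [_ []]]. }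
  exists (concat L1 ++ L2 ++ L3). intro x. change (S x <-> L x).
  (* Such an [h] differs from the element of [L2] listed for [(r, r')] by an element of the
     stabilizer of [r']. *)
  assert (hC : forall r r' h, In r R -> In r' R -> S h -> ae h r' = r -> L h).
  { intros r r' h hr hr' hh e.
    destruct (hL22 (r, r')) as [h0 [hh0 [hSh0 e0]]]; [now apply in_prod | exists h; auto |].
    simpl in e0. rewrite <- (gmulKV _ h0 h). apply subM; auto.
    - apply gen_in. apply in_or_app. right. apply in_or_app. now left.
    - destruct (hL12 r' hr') as [l [hl1 hl2]].
      { destruct (hE r') as [l hl]. exists l. exact hl. }
      assert (hSh : S (h0^-1 ** h)) by (apply subM; auto; now apply subV).
      assert (hg : gen (fun y => In y l) (h0^-1 ** h)).
      { apply hl2. split; [apply hSh|]. split; auto.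
        rewrite actEM, e, <- e0 by (auto; apply hSV; now apply subV).
        now apply ae_invK; auto. }
      refine (gen_mono _ _ hg).
      intros y hy. apply in_or_app. left. apply in_concat. eauto. }
  (* Two edges at [w] whose half-trees share a vertex coincide. *)
  assert (hKe : forall r r' y y' p, In r R -> In r' R -> S y -> S y' ->
     half T (ae y r) p -> half T (ae y' r') p -> L (y^-1 ** y')).
  { intros r r' y y' p hr hr' hy hy' hp hp'.
    assert (hSh : S (y^-1 ** y')) by (apply subM; auto; now apply subV).
    apply (hC r r'); auto.
    rewrite actEM by (auto; apply hSV; now apply subV).
    replace (ae y' r') with (ae y r); [now apply ae_invK; auto|].
    apply NNPP. intro hne. apply (half_disjoint hT (a := ae y r) (b := ae y' r') (v := p)); auto.
    rewrite !act_orig, !hRo, !hSw; auto. }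
  assert (hKu : forall x y y', K x y -> K x y' -> L (y^-1 ** y')).
  { intros z y y' [hy [[h1 e]|[h1 [r [hr h2]]]]] [hy' [[h1' e']|[h1' [r' [hr' h2']]]]].
    - rewrite e, e', gmulVl. now apply sub1.
    - now destruct h1'; apply hSw.
    - now destruct h1; apply hSw.
    - now apply (hKe r r' y y' (av z w)). }
  assert (hKt : forall h x y, S h -> H x -> K x y -> K (h ** x) (h ** y)).
  { intros h z y hh hz [hy [[h1 e]|[h1 [r [hr h2]]]]].
    - rewrite e. assert (S (h ** z)) by now apply subM. split; auto.
    - split; [now apply subM|]. right. rewrite actVM by auto. split.
      + intro E. apply h1. transitivity (av h^-1 (av h (av z w))).
        * symmetry. now apply av_invK; auto.
        * rewrite E. apply hSw. now apply subV.
      + exists r. rewrite actEM by auto. rewrite half_act; auto. }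
  assert (hLm : forall a b c : G, L (a^-1 ** b) -> L (b^-1 ** c) -> L (a^-1 ** c)).
  { intros a b c h1 h2. replace (a^-1 ** c) with ((a^-1 ** b) ** (b^-1 ** c)) by grp. now apply subM. }
  (* For a step that is not exceptional, either both points lie beyond the same first edge, or that
     edge separates them; then its [z^-1]-translate is in [P], which makes the step exceptional
     after all. *)
  assert (hstep : forall x f y y', H x -> In f F -> K x y -> K (x ** f) y' -> L (y^-1 ** y')).
  { intros z f y y' hz hf hy hy'.
    assert (hHf := generator_in _ hf).
    assert (hzf : H (z ** f)) by now apply subM.
    destruct (classic (exists z0, In z0 (Z ++ Z') /\ S (z ** z0^-1))) as [[z0 [hz0 hh]]|hno].
    - assert (hHz0 := hZH _ hz0). set (h := z ** z0^-1) in *.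
      assert (ez : z = h ** z0) by (unfold h; grp).
      destruct (hL32 (z0, f)) as [g [hg [y0 [y0' [h0 [h0' eg]]]]]].
      { now apply in_prod. }
      { destruct (hKex z0 hHz0) as [y0 h0]. destruct (hKex (z0 ** f)) as [y0' h0'].
        { now apply subM. }
        exists (y0^-1 ** y0'), y0, y0'. auto. }
      simpl in h0, h0'.
      apply (hLm y (h ** y0) y'); [|apply (hLm (h ** y0) (h ** y0') y')].
      + apply (hKu z); auto. rewrite ez. now apply hKt.
      + replace ((h ** y0)^-1 ** (h ** y0')) with g by (rewrite eg; grp).
        apply gen_in. apply in_or_app. right. apply in_or_app. now right.
      + apply (hKu (z ** f)); auto. rewrite ez, gmul_assoc_r. apply hKt; auto. now apply subM.
    - destruct hy as [hy [[h1 e]|[h1 [r [hr h2]]]]].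
      { exfalso. apply hno. exists gone. split; [now left|]. now rewrite ginv1, gmul1r. }
      destruct hy' as [hy' [[h1' e']|[h1' [r' [hr' h2']]]]].
      { exfalso. apply hno. exists f^-1. rewrite ginvK. split; auto.
        right. apply in_or_app. left. now apply in_map. }
      destruct (classic (half T (ae y r) (av (z ** f) w))) as [h3|h3].
      + now apply (hKe r r' y y' (av (z ** f) w)).
      + exfalso. assert (hp : In (ae z^-1 (ae y r)) P).
        { apply (hP f); auto. set (a := ae y r) in *. rewrite !half_act_l by (auto; apply hHV; now apply subV).
          rewrite ginvK, <- actVM by auto. tauto. }
        assert (ho : o (ae y r) = w) by (rewrite act_orig, hRo, hSw; auto).
        destruct (hZ2 _ hp) as [z0 [hz0 [hHz0 ez0]]].
        { exists z. split; auto. now rewrite ae_Kinv; auto. }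
        apply hno. exists z0. split; [apply in_or_app; now right|].
        assert (hzz : H (z ** z0^-1)) by (apply subM; auto; now apply subV).
        repeat split; auto. rewrite <- ez0 at 1. rewrite <- act_orig by auto.
        rewrite actEM by (auto; apply hHV; now apply subV).
        rewrite (ae_invK T hV); [|auto]. now rewrite (ae_Kinv T hV); [|auto]. }
  assert (hQ : forall x, H x -> H x /\ forall z y y', H z -> K z y -> K (z ** x) y' -> L (y^-1 ** y')).
  { intros z0 hz0. apply hF in hz0. pattern z0. apply hz0.
    - split; [|split].
      + split; [now apply sub1|]. intros z y y' hz h h'. rewrite gmul1r in h'. eauto.
      + intros a b [ha ea] [hb eb]. split; [now apply subM|]. intros z y y' hz h h'.
        destruct (hKex (z ** a)) as [y1 h1]; [now apply subM|].
        apply (hLm y y1 y'); [now apply (ea z)|]. apply (eb (z ** a)); auto; [now apply subM|].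
        now rewrite gmul_assoc_r.
      + intros a [ha ea]. split; [now apply subV|]. intros z y y' hz h h'.
        rewrite <- (ginvK _ (y^-1 ** y')). apply subV; auto. rewrite ginvM, ginvK.
        apply (ea (z ** a^-1)); auto; [apply subM; auto; now apply subV|].
        now replace (z ** a^-1 ** a) with z by grp.
    - intros f hf. split; [now apply generator_in|]. intros z y y' hz h h'. eauto. }
  split.
  (* [K] relates [gone] to itself and [x] to itself, so passing from [gone] to [x] puts
     [gone^-1 ** x] in [L]. *)
  - intro hx. rewrite <- (gmul1l _ x), <- (ginv1 G).
    apply (proj2 (hQ x (proj1 hx)) gone); [now apply sub1| |].
    + split; [now apply sub1|]. left. split; auto. now apply sub1.
    + rewrite gmul1l. split; auto.
  - intro hx. apply hx; auto. intros y hy. apply in_app_or in hy as [hy|hy].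
    + apply in_concat in hy as [l [hl hy]]. destruct (hL11 l hl) as [r [hr h]].
      destruct (proj2 (h y)) as [h1 h2]; [now apply gen_in|]. split; auto.
      rewrite <- (hRo r hr). now apply estab_vstab.
    + apply in_app_or in hy as [hy|hy].
      * now destruct (hL21 y hy) as [rr [_ []]].
      * destruct (hL31 y hy) as [zf [_ [y0 [y0' [[h1 _] [[h2 _] ->]]]]]].
        apply subM; auto. now apply subV.
Qed.

End FinitelyGeneratedActions.

(** * Cyclic groups acting on trees *)

Definition double_finite (G : group) (V H C : G -> Prop) : Prop :=
  exists l : list G, (forall r, In r l -> V r) /\
    forall x, V x -> exists h r c, H h /\ In r l /\ C c /\ x = h ** r ** c.
Arguments double_finite {G}.

Section HyperbolicDynamics.
Variables (G : group) (V : G -> Prop) (T : tree_action G V).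
Hypothesis hV : is_subgroup V.
Hypothesis hT : is_tree T.

Local Notation o := (torig T).
Local Notation t := (tterm T).
Local Notation bar := (tbar T).
Local Notation av := (actV T).
Local Notation ae := (actE T).
Local Notation half := (half T).
Implicit Types (a b e f : tE T) (p q u v z : tV T).

(** If [z] never entered, all edges [x^-n f] would separate [t f] from [z]; two of them would
    coincide, so a positive power of [x] would fix [f], against the proper inclusion. *)
Lemma attracting_half x f : V x -> ae x f <> f ->
  (forall v, half (ae x f) v -> half f v) ->
  forall z, exists N, forall n, N <= n -> half f (av (gpow x n) z).
Proof.
  intros hx hne hsub z.
  assert (hpow : forall n, V (gpow x n)) by (intro n; now apply gpow_sub).
  assert (hstep : forall v, half f v -> half f (av x v)).
  { intros v h. apply hsub. now apply half_act. }
  assert (hmon : forall n v, half f v -> half f (av (gpow x n) v)).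
  { induction n as [|n IH]; intros v h; simpl; [now rewrite actV1|].
    rewrite actVM by auto. auto. }
  destruct (classic (exists n, half f (av (gpow x n) z))) as [[N hN]|hno].
  - exists N. intros n hn. replace n with (n - N + N) by lia.
    rewrite gpowD, actVM by auto. now apply hmon.
  - exfalso. destruct (separating_edges_finite hT (t f) z) as [l hl].
    destruct (pigeonhole l (fun n a => ae (gpow x n) a = f)) as [m [n [a [hmn [em en]]]]].
    { intro n. exists (ae (gpow x n)^-1 f). split; [|now apply ae_Kinv].
      apply hl; rewrite half_act_l by (auto; now apply subV); rewrite ginvK.
      - apply hmon, half_term.
      - intro h. apply hno. now exists n. }
    apply hne, (half_eq hT). intro v. split; [auto|]. intro hv.
    (* The exponent [n - m] is written as a successor so that one factor [x] splits off. *)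
    assert (e : ae (gpow x (S (n - S m))) f = f).
    { rewrite <- em at 1. rewrite <- actEM by auto. rewrite <- gpowD.
      now replace (S (n - S m) + m) with n by lia. }
    rewrite <- e in hv. simpl in hv. rewrite actEM in hv by auto.
    rewrite half_act_l in hv |- * by auto.
    rewrite <- (av_Kinv T hV (gpow x (n - S m)) (av x^-1 v) (hpow _)). apply hmon.
    now rewrite <- half_act_l.
Qed.

(** Of the positions in [half_cases], disjointness is excluded by the common vertex;
    [ae x f = bar f] is excluded since there are no inversions. *)
Lemma half_shrinks x f : V x -> ae x f <> f ->
  (exists v, half f v /\ half (ae x f) v) ->
  (forall v, half (ae x f) v -> half f v) \/
  (ae x^-1 f <> f /\ forall v, half (ae x^-1 f) v -> half f v) \/
  (forall v, ~ half f v -> half f (av x v)).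
Proof.
  intros hx hne [v [h1 h2]].
  destruct (half_cases hT (e := f) (f := ae x f)) as [h|[h|[h|h]]]; auto.
  - intro E. now apply (act_noinv T x f hx).
  - right. left. split.
    + intro E. apply hne. rewrite <- E at 1. now apply ae_Kinv.
    + intros u hu. rewrite half_act_l in hu by (auto; now apply subV). rewrite ginvK in hu.
      apply h in hu. now rewrite half_act in hu.
  - now destruct (h v).
  - right. right. intros u hu. apply h. now rewrite half_act.
Qed.

(** If [x] moved [a], then in each case of [half_shrinks] some power of [x] or of [x^-1] would bring
    the fixed vertex [p] into [half a]. *)
Lemma fixed_edge x p a : V x -> av x p = p -> ~ half a p ->
  (exists v, half a v /\ half (ae x a) v) -> ae x a = a.
Proof.
  intros hx hp ha hv. apply NNPP. intro hne.
  assert (hfix : forall y n, av y p = p -> V y -> av (gpow y n) p = p).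
  { intros y n e hy. induction n as [|n IH]; simpl; [apply actV1|].
    rewrite actVM, IH; auto. now apply gpow_sub. }
  destruct (half_shrinks hx hne hv) as [h|[[hne' h]|h]].
  - destruct (attracting_half hx hne h p) as [N hN]. apply ha.
    rewrite <- (hfix x N); auto.
  - assert (hx' : V x^-1) by now apply subV.
    destruct (attracting_half hx' hne' h p) as [N hN]. apply ha.
    rewrite <- (hfix x^-1 N); auto. rewrite <- hp at 1. now apply av_invK.
  - apply ha. rewrite <- hp. auto.
Qed.

(** * Half-trees under the action of a cyclic group *)

Section CyclicPart.
Variable C : G -> Prop.
Hypothesis hC : is_subgroup C.
Hypothesis hCc : is_cyclic C.
Hypothesis hCV : forall x, C x -> V x.

(** The first clause makes the inclusion proper and rules out [n = 0]. *)
Definition attracts (d : G) f : Prop := exists n,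
  ae (gpow d n) f <> f /\ forall v, half (ae (gpow d n) f) v -> half f v.

Definition swallows f : Prop := exists x, C x /\ forall v, ~ half f v -> half f (av x v).

Definition disjoint_halves f f' : Prop := forall v, half f v -> half f' v -> False.

Lemma attracts_meet d f f' : V d -> attracts d f -> attracts d f' -> ~ disjoint_halves f f'.
Proof.
  intros hd [n [hn hf]] [n' [hn' hf']] hdis.
  assert (hpow : forall n, V (gpow d n)) by (intro; now apply gpow_sub).
  destruct (attracting_half (hpow n) hn hf (o f)) as [N hN].
  destruct (attracting_half (hpow n') hn' hf' (o f)) as [N' hN'].
  assert (n <> 0) by (intros ->; apply hn, actE1).
  assert (n' <> 0) by (intros ->; apply hn', actE1).
  (* The exponent is a common multiple of [n] and [n'] that stays large enough after division by
     either. *)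
  apply (hdis (av (gpow d (n * (n' * (N + N')))) (o f))).
  - rewrite gpowM. apply hN. nia.
  - replace (n * (n' * (N + N'))) with (n' * (n * (N + N'))) by lia.
    rewrite gpowM. apply hN'. nia.
Qed.

(** Disjointness makes [x] map [half f] into [half f']. A high power [y] of [d] commutes with [x],
    so the vertex [y x (t f) = x y (t f)] lies in both half-trees. *)
Lemma attracts_swallows_meet d f f' : C d -> attracts d f -> swallows f' -> ~ disjoint_halves f f'.
Proof.
  intros hd [n [hn hf]] [x [hx hf']] hdis.
  assert (hpow : forall n, C (gpow d n)) by (intro; now apply gpow_sub).
  assert (hin : forall v, half f v -> half f' (av x v)).
  { intros v hv. apply hf'. intro h. eauto. }
  destruct (attracting_half (hCV (hpow n)) hn hf (av x (t f))) as [N hN].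
  destruct (attracting_half (hCV (hpow n)) hn hf (t f)) as [N' hN'].
  set (y := gpow (gpow d n) (N + N')).
  assert (hy : C y) by now apply gpow_sub.
  apply (hdis (av y (av x (t f)))).
  - apply hN. lia.
  - rewrite <- actVM, (cyclic_comm y x hCc hy hx), actVM by auto.
    apply hin, hN'. lia.
Qed.

(** By commutativity [x] maps [half f] into [half f'], and it maps the complement of [half f] into
    [half f]. So every vertex lies in one of these two, and none is left for [half f'']. *)
Lemma swallows_meet f f' f'' : swallows f -> swallows f' ->
  disjoint_halves f f' -> disjoint_halves f f'' -> ~ disjoint_halves f' f''.
Proof.
  intros [x [hx hf]] [y [hy hf']] h1 h2 h3.
  assert (hin : forall v, half f v -> half f' (av x v)).
  { intros v hv. apply NNPP. intro hn.
    assert (hv' : half f (av x (av y v))) by (apply hf; intro h; apply (h1 (av y v)); auto;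
      exfalso; apply (h1 (av y v)); auto; apply hf'; intro; eauto).
    apply hf' in hn. apply (h1 (av x (av y v))); auto.
    rewrite <- actVM, (cyclic_comm x y hCc hx hy), actVM; auto. }
  pose (z := av x^-1 (t f'')).
  assert (hz : av x z = t f'') by (apply av_Kinv; auto).
  destruct (classic (half f z)) as [h|h].
  - apply (h3 (t f'')); [rewrite <- hz; auto | apply half_term].
  - apply (h2 (t f'')); [rewrite <- hz; auto | apply half_term].
Qed.

Definition steady f : Prop := forall x, C x -> (exists v, half f v /\ half (ae x f) v) -> ae x f = f.

(** Elements of [C] are powers of [c] or of [c^-1], so the first two cases of [half_shrinks] give
    attraction; the third gives swallowing. *)
Lemma unsteady_types : exists c, C c /\ forall f, ~ steady f ->
  attracts c f \/ attracts c^-1 f \/ swallows f.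
Proof.
  destruct hCc as [c [hc hcC]]. exists c. split; auto. intros f hf.
  apply NNPP. intro hno. apply hf. intros x hx hv. apply NNPP. intro hne. apply hno.
  assert (hatt : forall y, C y -> ae y f <> f -> (forall v, half (ae y f) v -> half f v) ->
    attracts c f \/ attracts c^-1 f).
  { intros y hy h1 h2. apply hcC in hy as [n [->| ->]]; [left|right]; exists n; auto. }
  destruct (half_shrinks (hCV hx) hne hv) as [h|[[hne' h]|h]].
  - destruct (hatt x); auto.
  - destruct (hatt x^-1); auto. now apply subV.
  - right. right. exists x. auto.
Qed.

(** Disjoint half-trees cannot attract in the same direction, nor can one attract while another
    swallows. As there are only two directions, three unsteady ones would all swallow, against
    [swallows_meet]. *)
Lemma steady_among_three f1 f2 f3 : disjoint_halves f1 f2 -> disjoint_halves f1 f3 ->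
  disjoint_halves f2 f3 -> steady f1 \/ steady f2 \/ steady f3.
Proof.
  intros h12 h13 h23.
  assert (hsym : forall f f', disjoint_halves f f' -> disjoint_halves f' f).
  { intros f f' h v h1 h2. eauto. }
  destruct unsteady_types as [c [hc hty]].
  assert (hc' : C c^-1) by now apply subV.
  assert (hcV := hCV hc). assert (hcV' := hCV hc').
  apply NNPP. intro hno.
  destruct (hty f1) as [a1|[a1|a1]]; [tauto|..];
  destruct (hty f2) as [a2|[a2|a2]]; try tauto;
  destruct (hty f3) as [a3|[a3|a3]]; try tauto;
  assert (h21 := hsym _ _ h12); assert (h31 := hsym _ _ h13); assert (h32 := hsym _ _ h23);
  match goal with
  | a : attracts ?d ?f, a' : attracts ?d ?f', h : disjoint_halves ?f ?f' |- _ =>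
      apply (attracts_meet (d := d) (f := f) (f' := f')); assumption
  | a : attracts ?d ?f, a' : swallows ?f', h : disjoint_halves ?f ?f' |- _ =>
      apply (attracts_swallows_meet (d := d) (f := f) (f' := f')); assumption
  | a : swallows ?f, a' : swallows ?f', h : disjoint_halves ?f ?f',
    h' : disjoint_halves ?f ?f'', h'' : disjoint_halves ?f' ?f'' |- _ =>
      apply (swallows_meet (f := f) (f' := f') (f'' := f'')); assumption
  end.
Qed.

End CyclicPart.

Lemma separating_edge_on_path b a l : is_path T (a :: l) ->
  ~ half b (o a) -> half b (t (last l a)) -> In b (a :: l).
Proof.
  revert a. induction l as [|c l IH]; intros a hl h1 h2;
    destruct (classic (a = b)) as [->|hne]; try (now left);
    destruct (classic (a = bar b)) as [->|hne'];
    try (exfalso; apply h1; exact (half_term T b));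
    rewrite (half_edge (conj hne hne' : avoids T b a)) in h1.
  - easy.
  - right. destruct hl as [h3 h4]. rewrite last_cons in h2. apply IH; auto. now rewrite <- h3.
Qed.

Lemma reduced_is_path l : is_reduced_path T l -> is_path T l.
Proof.
  induction l as [|a l IH]; [easy|]. destruct l as [|b l]; [easy|].
  intros [h1 [h2 h3]]. split; auto.
Qed.

(** The geodesic from [p] to [q] contains all of [E], hence is longer than [k], and [fixed_edge]
    shows that [x] fixes each of its edges. *)
Lemma acylindrical_trivial k x p q (E : list (tE T)) : k_acylindrical T k -> V x ->
  av x p = p -> av x q = q -> NoDup E -> k < length E ->
  (forall a, In a E -> half a q /\ ~ half a p) -> x = gone.
Proof.
  intros hk hx hp hq hE hlen hsep.
  destruct (classic (p = q)) as [->|hpq].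
  { destruct E as [|a E]; [simpl in hlen; lia|]. destruct (hsep a) as [h1 h2]; [now left|easy]. }
  destruct (reduced_path_exists hT hpq) as [a [l [hr [ho ht]]]].
  assert (hincl : incl E (a :: l)).
  { intros b hb. destruct (hsep b hb) as [h1 h2].
    apply separating_edge_on_path; [now apply reduced_is_path | now rewrite ho | now rewrite ht]. }
  apply (hk (a :: l)); auto.
  - apply NoDup_incl_length in hincl; auto. lia.
  - intros b hb. destruct (reduced_half hT hr hb) as [h1 h2].
    assert (hbq : half b q) by (rewrite <- ht; apply h2, half_term).
    apply (fixed_edge (p := p)); auto.
    + rewrite <- ho. intro h. now apply (half_orig hT (h1 _ h)).
    + exists q. split; auto. rewrite <- hq. now apply half_act.
Qed.

End HyperbolicDynamics.

(** * Ping-pong with half-trees *)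

Section PingPong.
Variables (G : group) (V : G -> Prop) (T : tree_action G V).
Hypothesis hV : is_subgroup V.
Hypothesis hT : is_tree T.

Local Notation o := (torig T).
Local Notation t := (tterm T).
Local Notation bar := (tbar T).
Local Notation av := (actV T).
Local Notation ae := (actE T).
Local Notation half := (half T).

(** This supplies the ping-pong data. The edge [e] begins the geodesic from [w] to [g w]. A rotation
    about [w] moves [half e] off itself, and [s], a rotation about [g w], then brings it back inside
    [half e]. *)
Lemma branching_edge w g : V g -> av g w <> w ->
  (forall e, o e = w -> exists s1 s2, vstab T w s1 /\ vstab T w s2 /\
     ae s1 e <> e /\ ae s2 e <> e /\ ae s1 e <> ae s2 e) ->
  exists e t1 t2 s, o e = w /\ V t1 /\ V t2 /\ V s /\
    (forall v, half (ae t1 e) v -> half e v) /\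
    (forall v, half (ae t2 e) v -> half e v) /\
    (forall v, half (ae t1 e) v -> half (ae t2 e) v -> False) /\
    (forall v, ~ half e v -> half e (av s v)).
Proof.
  intros hg hgw hbr.
  destruct (reduced_path_exists hT (p := w) (q := av g w)) as [e [l [hr [ho ht]]]]; auto.
  assert (hgV : V g^-1) by now apply subV.
  destruct (hbr e ho) as [s1 [s2 [[h1 f1] [[h2 f2] [n1 [n2 n12]]]]]].
  set (b := last l e) in *.
  destruct (hbr (ae g^-1 (bar b))) as [s' [_ [[h3 f3] [_ [n3 _]]]]].
  { rewrite act_orig by auto. change (o (bar b)) with (t b). rewrite ht. now apply av_invK. }
  (* [s] fixes [g w] and moves the reversed last edge [bar b], so it maps [half (bar b)] into
     [half b]. *)
  set (s := g ** s' ** g^-1).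
  assert (hs : V s) by (apply subM; auto; now apply subM).
  assert (hse : half b (t b)) by apply half_term.
  assert (hbe : forall v, half b v -> half e v).
  { apply (@reduced_half _ _ _ hT e l e); auto. now left. }
  assert (hsX : forall v, ~ half e v -> half e (av s v)).
  { intros v hv. apply hbe. apply NNPP. intro hn.
    apply (half_disjoint hT (a := bar b) (b := ae s (bar b)) (v := av s v)).
    - rewrite act_orig by auto. change (o (bar b)) with (t b). rewrite ht. unfold s.
      rewrite !actVM by (auto; now apply subM). rewrite (av_invK T hV) by auto. now rewrite f3.
    - intro E. apply n3. unfold s in E.
      rewrite !actEM in E by (auto; now apply subM).
      apply (ae_inj T hV g); auto. now rewrite <- E, (ae_Kinv T hV).
    - now apply half_bar.
    - apply half_act; auto. apply half_bar; auto. }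
  assert (hsub : forall s1, V s1 -> av s1 w = w -> ae s1 e <> e ->
    forall v, half (ae (s ** s1) e) v -> half e v).
  { intros s0 h0 f0 n0 v hv. rewrite actEM, half_act_l in hv by auto.
    rewrite <- (av_Kinv T hV s v hs). apply hsX. intro h.
    apply (half_disjoint hT (a := e) (b := ae s0 e) (v := av s^-1 v)); auto.
    rewrite act_orig, ho, f0; auto. }
  exists e, (s ** s1), (s ** s2), s.
  split; [auto|]. split; [now apply subM|]. split; [now apply subM|]. split; [auto|].
  split; [now apply hsub|]. split; [now apply hsub|]. split; [|exact hsX].
  intros v hv1 hv2. rewrite actEM, half_act_l in hv1, hv2 by auto.
  apply (half_disjoint hT (a := ae s1 e) (b := ae s2 e) (v := av s^-1 v)); auto.
  rewrite !act_orig, ho; congruence.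
Qed.

Variables (e0 : tE T) (t1 t2 s : G) (k : nat).
Hypothesis hk : k_acylindrical T k.
Hypothesis ht1 : V t1.
Hypothesis ht2 : V t2.
Hypothesis hs : V s.
Hypothesis t1_in : forall v, half (ae t1 e0) v -> half e0 v.
Hypothesis t2_in : forall v, half (ae t2 e0) v -> half e0 v.
Hypothesis t12_disjoint : forall v, half (ae t1 e0) v -> half (ae t2 e0) v -> False.
Hypothesis s_in : forall v, ~ half e0 v -> half e0 (av s v).

Local Notation X g v := (half (ae g e0) v).

Lemma translate_sub g h h' : V g -> V h -> V h' -> (forall v, X h v -> X h' v) ->
  forall v, X (g ** h) v -> X (g ** h') v.
Proof.
  intros hg hh hh' H v. rewrite !actEM, !(half_act_l T hV g) by auto. apply H.
Qed.

Lemma translate_act g h v : V g -> V h -> (X (g ** h) (av g v) <-> X h v).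
Proof. intros hg hh. rewrite actEM by auto. now apply half_act. Qed.

Lemma pow_t1 n : V (gpow t1 n).
Proof. now apply gpow_sub. Qed.

Lemma chain_sub m n : m <= n -> forall v, X (gpow t1 n) v -> X (gpow t1 m) v.
Proof.
  assert (hone : forall n v, X (gpow t1 n) v -> half e0 v).
  { intro i. induction i as [|j IH]; intro v; [simpl; now rewrite actE1|].
    simpl. intro h. apply t1_in. rewrite <- (gmul1r _ t1).
    refine (translate_sub ht1 (pow_t1 j) (sub1 hV) _ h).
    intro u. rewrite actE1. auto. }
  intros hmn v. replace n with (m + (n - m)) by lia. rewrite gpowD.
  rewrite <- (gmul1r _ (gpow t1 m)) at 2.
  apply translate_sub; auto using pow_t1.
  - now apply sub1.
  - intro u. rewrite actE1. apply hone.
Qed.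

(** These translates hang off the decreasing chain of translates by powers of [t1]. For [m < n] the
    branch at [n] lies beyond [gpow t1 (S m)], which is disjoint from the branch at [m]. *)
Definition branch n : G := gpow t1 n ** t2.

Lemma branch_V n : V (branch n).
Proof. unfold branch. apply subM; auto using pow_t1. Qed.

Lemma branch_chain n v : X (branch n) v -> X (gpow t1 n) v.
Proof.
  unfold branch. rewrite <- (gmul1r _ (gpow t1 n)) at 2. apply translate_sub; auto using pow_t1.
  - now apply sub1.
  - intro u. rewrite actE1. auto.
Qed.

Lemma branch_in g n v : V g -> X (g ** branch n) v -> X g v.
Proof.
  intros hg h. rewrite <- (gmul1r _ g).
  refine (translate_sub hg (branch_V n) (sub1 hV) _ h).
  intros u hu. apply (chain_sub (m := 0) (n := n)); [lia|]. now apply branch_chain.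
Qed.

Lemma branch_disjoint g m n v : V g -> m < n -> X (g ** branch m) v -> X (g ** branch n) v -> False.
Proof.
  intros hg hmn. rewrite !actEM, !(half_act_l T hV g) by auto using branch_V.
  generalize (av g^-1 v). clear v. intros v h1 h2.
  apply branch_chain in h2. apply (chain_sub (m := S m)) in h2; [|lia].
  unfold branch in h1. rewrite gpowSr in h2.
  rewrite !actEM, !(half_act_l T hV (gpow t1 m)) in h1, h2 by auto using pow_t1.
  eauto.
Qed.

Lemma chain_inj m n : ae (gpow t1 m) e0 = ae (gpow t1 n) e0 -> m = n.
Proof.
  assert (H : forall m n, m < n -> ae (gpow t1 m) e0 <> ae (gpow t1 n) e0).
  { intros a b hab E. set (v := t (ae (branch a) e0)).
    assert (hv : X (branch a) v) by apply half_term.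
    assert (hb : X (gpow t1 (S a)) v).
    { apply (chain_sub (m := S a) (n := b)); [lia|]. rewrite <- E. now apply branch_chain. }
    unfold branch in hv. rewrite gpowSr in hb.
    rewrite !actEM, !(half_act_l T hV (gpow t1 a)) in hv, hb by auto using pow_t1. eauto. }
  intro E. destruct (lt_eq_lt_dec m n) as [[h|h]|h]; auto; exfalso.
  - now apply (H m n).
  - now apply (H n m).
Qed.

Lemma ping_pong_infinite : ~ exists l : list G, forall x, V x -> In x l.
Proof.
  intros [l hl].
  destruct (pigeonhole l (fun n a => a = branch n)) as [m [n [a [hmn [-> E]]]]].
  { intro n. exists (branch n). split; auto. apply hl, branch_V. }
  apply (@branch_disjoint gone m n (t (ae (gone ** branch m) e0))); auto.
  - now apply sub1.
  - apply half_term.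
  - rewrite <- E. apply half_term.
Qed.

(** One of three disjoint branches is steady. An element of [C] that fails to displace the half-tree
    [k] steps further down fixes both the steady edge and the deeper one, so acylindricity makes it
    trivial. *)
Lemma displaced_half C : is_subgroup C -> is_cyclic C -> (forall x, C x -> V x) ->
  exists g, V g /\ forall x, C x -> x <> gone -> forall v, X g v -> X (x ** g) v -> False.
Proof.
  intros hC hCc hCV.
  assert (hsteady : exists g, V g /\ steady T C (ae g e0)).
  { assert (hd : forall m n, m < n -> disjoint_halves T (ae (branch m) e0) (ae (branch n) e0)).
    { intros m n hmn v. rewrite <- (gmul1l _ (branch m)), <- (gmul1l _ (branch n)).
      apply branch_disjoint; auto. now apply sub1. }
    destruct (@steady_among_three _ _ _ hV hT C hC hCc hCV (ae (branch 0) e0) (ae (branch 1) e0)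
      (ae (branch 2) e0)) as [h|[h|h]]; try (apply hd; lia); eauto using branch_V. }
  destruct hsteady as [g [hg hst]].
  assert (hchain : forall i j, i <= j -> forall v, X (g ** gpow t1 j) v -> X (g ** gpow t1 i) v).
  { intros i j hij. apply translate_sub; auto using pow_t1. now apply chain_sub. }
  exists (g ** gpow t1 k). assert (hgk : V (g ** gpow t1 k)) by (apply subM; auto using pow_t1).
  split; auto. intros x hx hne v h1 h2. apply hne. assert (hxV := hCV x hx).
  assert (hi : forall i, i <= k -> ~ X (g ** gpow t1 i) (o (ae g e0))).
  { intros i _ h. apply (hchain 0 i) in h; [|lia]. simpl in h. rewrite gmul1r in h.
    now apply half_orig in h. }
  assert (e1 : ae x (ae g e0) = ae g e0).
  { apply hst; auto. exists v. rewrite <- actEM by auto.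
    assert (h3 := hchain 0 k (Nat.le_0_l k)). simpl in h3. rewrite gmul1r in h3. split; auto.
    refine (translate_sub hxV hgk hg h3 h2). }
  assert (p1 : av x (o (ae g e0)) = o (ae g e0)) by (rewrite <- act_orig, e1; auto).
  set (f := ae (g ** gpow t1 k) e0) in *.
  assert (e2 : ae x f = f).
  { apply (@fixed_edge _ _ T hV hT x (o (ae g e0)) f); auto; [now apply (hi k)|].
    exists v. split; auto. unfold f. now rewrite <- actEM. }
  (* The exponents from [0] to [k] give [k + 1] distinct edges, just more than acylindricity
     allows. *)
  apply (@acylindrical_trivial _ _ T hV hT k x (o (ae g e0)) (t f)
    (map (fun i => ae (g ** gpow t1 i) e0) (seq 0 (S k)))); auto.
  - rewrite <- act_term, e2; auto.
  - apply Injective_map_NoDup; [|apply seq_NoDup].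
    intros i j E. rewrite !actEM in E by auto using pow_t1.
    apply ae_inj in E; auto. now apply chain_inj.
  - rewrite length_map, length_seq. lia.
  - intros a ha. apply in_map_iff in ha as [i [<- hik]]. apply in_seq in hik. split.
    + apply (hchain i k); [lia|]. apply half_term.
    + apply hi. lia.
Qed.

Section Subgroup.
Variable H : G -> Prop.
Hypothesis hH : is_subgroup H.
Hypothesis hHV : forall x, H x -> V x.

(** Suppose the orbit is confined. In [n ** c = c ** (c^-1 ** n ** c)] the last factor is in [H], so
    the [g]-translate contains both [c] and [n ** c] applied to [o e0], although [n] displaces
    it. *)
Lemma escape_normal N : is_subgroup N -> (forall x, N x -> H x) ->
  (forall g x, V g -> N x -> N (g^-1 ** (x ** g))) -> nontrivial N ->
  forall d, V d -> exists h, H h /\ ~ X d (av h (o e0)).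
Proof.
  intros hN hNH hnorm [n [hn hn1]] d hd.
  assert (hnV : V n) by auto.
  destruct (displaced_half (cyc_sub _ n) (cyc_cyclic _ n)) as [g [hg hdis]].
  { intros x [j [->| ->]]; apply gpow_sub; auto. now apply subV. }
  apply NNPP. intro hno.
  assert (hall : forall h, H h -> X d (av h (o e0))).
  { intros h hh. apply NNPP. eauto. }
  assert (hdg : V (g ** d^-1)) by (apply subM; auto; now apply subV).
  set (c := g ** d^-1) in *.
  assert (egc : g = c ** d) by (unfold c; grp).
  apply (hdis n (cyc_self _ n) hn1 (av (n ** c) (o e0))).
  - rewrite egc. replace (n ** c) with (c ** (c^-1 ** (n ** c))) by grp.
    assert (hm : N (c^-1 ** (n ** c))) by auto.
    rewrite actVM by auto. apply translate_act; auto.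
  - rewrite egc. rewrite gmulA. apply translate_act; auto; [now apply subM|].
    rewrite <- (actV1 T (o e0)). apply hall. now apply sub1.
Qed.

(** If the orbit is confined, [c n] carries it into the translate by [g ** branch n]. Two of the
    inverses [(c n)^-1] share a double coset, which gives [c n ** h = z ** c m] with [h] in [H] and
    [z] in [C]. The choice of [g] forces [z = gone], and then two disjoint branches meet. *)
Lemma escape_double C : is_subgroup C -> is_cyclic C -> (forall x, C x -> V x) ->
  double_finite V H C ->
  forall d, V d -> exists h, H h /\ ~ X d (av h (o e0)).
Proof.
  intros hC hCc hCV [l [hl hdf]] d hd.
  destruct (displaced_half hC hCc hCV) as [g [hg hdis]].
  apply NNPP. intro hno.
  assert (hall : forall h, H h -> X d (av h (o e0))).
  { intros h hh. apply NNPP. eauto. }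
  pose (c n := g ** branch n ** d^-1).
  assert (hc : forall n, V (c n)).
  { intro n. apply subM; auto; [|now apply subV]. apply subM; auto using branch_V. }
  assert (ec : forall n, g ** branch n = c n ** d) by (intro n; unfold c; grp).
  assert (hin : forall n h, H h -> X (g ** branch n) (av (c n ** h) (o e0))).
  { intros n h hh. rewrite ec, actVM by auto. apply translate_act; auto. }
  destruct (pigeonhole l (fun n r => exists h y, H h /\ C y /\ (c n)^-1 = h ** r ** y))
    as [m [n [r [hmn [[h [y [hh [hy em]]]] [h' [y' [hh' [hy' en]]]]]]]]].
  { intro n. destruct (hdf (c n)^-1) as [h [r [y [h1 [h2 [h3 h4]]]]]]; [now apply subV|].
    exists r. eauto 6. }
  assert (hz : C (y'^-1 ** y)) by (apply subM; auto; now apply subV).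
  set (z := y'^-1 ** y) in *.
  assert (hq : H (h' ** h^-1)) by (apply subM; auto; now apply subV).
  assert (E : c n ** (h' ** h^-1) = z ** c m).
  { rewrite <- (ginvK _ (c m)), <- (ginvK _ (c n)), em, en. unfold z. grp. }
  assert (h1 := hin m gone (sub1 hH)). rewrite gmul1r in h1.
  assert (h2 := hin n _ hq). rewrite E, actVM in h2 by auto.
  assert (hz1 : z = gone).
  { apply NNPP. intro hne. apply (hdis z hz hne (av z (av (c m) (o e0)))).
    - now apply (@branch_in g n).
    - apply translate_act; auto. now apply (@branch_in g m). }
  rewrite hz1, actV1 in h2. exact (branch_disjoint hg hmn h1 h2).
Qed.

(** Escaping from the translates by [x] and by [x ** s^-1] shows that [ae x e0] separates two orbit
    points; so some [H]-translate of it is in the finite list [P]. *)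
Lemma escape_double_finite : fin_generated H ->
  (forall d, V d -> exists h, H h /\ ~ X d (av h (o e0))) ->
  double_finite V H (estab T e0).
Proof.
  intros [F hF] hesc.
  destruct (generator_separating_edges hT F (o e0)) as [P hP].
  destruct (list_choice (fun p r => V r /\ ae r e0 = p) P) as [R [hR1 hR2]].
  exists R. split.
  { intros r hr. now destruct (hR1 r hr) as [p [_ []]]. }
  intros x hx.
  assert (hs' : V (x ** s^-1)) by (apply subM; auto; now apply subV).
  destruct (hesc (x ** s^-1) hs') as [x1 [h1 n1]].
  destruct (hesc x hx) as [x2 [h2 n2]].
  destruct (@orbit_separating_edge _ _ T hV H F (o e0) hHV hF P (ae x e0) x1 x2) as [z [hz hzP]]; auto.
  (* A point outside the translate by [x ** s^-1] is inside the one by [x], since [s] maps the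
     complement of the half-tree into it. *)
  - apply NNPP. intro hn. apply n1.
    rewrite half_act_l in hn by auto. apply s_in in hn.
    rewrite half_act_l by auto. rewrite ginvM, ginvK, actVM; auto. now apply subV.
  - destruct (hR2 _ hzP) as [r [hr [hrV er]]].
    { exists (z ** x). split; [apply subM; auto|]. now rewrite actEM; auto. }
    exists z^-1, r, (r^-1 ** (z ** x)). repeat split; auto.
    + now apply subV.
    + apply subM; [auto|now apply subV|]. apply subM; auto.
    + rewrite !actEM by (auto; try apply subM; auto; now apply subV).
      rewrite <- er. now apply ae_invK.
    + grp.
Qed.

End Subgroup.
End PingPong.

Definition has_normal_subgroup (G : group) (V H : G -> Prop) : Prop :=
  exists N : G -> Prop, is_subgroup N /\ (forall x, N x -> H x) /\
    (forall g x, V g -> N x -> N (g^-1 ** (x ** g))) /\ nontrivial N.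
Arguments has_normal_subgroup {G}.

Definition cyclic_double_finite (G : group) (V H : G -> Prop) : Prop :=
  exists C : G -> Prop, is_subgroup C /\ is_cyclic C /\ (forall x, C x -> V x) /\
    double_finite V H C.
Arguments cyclic_double_finite {G}.

(** The edge is found before [H] is given, so one edge stabilizer serves all subgroups [H]. *)
Theorem irreducible_tree_double_finite (G : group) (V : G -> Prop) (T : tree_action G V) w g :
  is_subgroup V -> is_tree T -> acylindrical T -> V g -> actV T g w <> w ->
  (forall e, torig T e = w -> exists s1 s2, vstab T w s1 /\ vstab T w s2 /\
     actE T s1 e <> e /\ actE T s2 e <> e /\ actE T s1 e <> actE T s2 e) ->
  (~ exists l : list G, forall x, V x -> In x l) /\
  exists e, torig T e = w /\
    forall H, fin_generated H -> (forall x, H x -> V x) ->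
      has_normal_subgroup V H \/ cyclic_double_finite V H ->
      double_finite V H (estab T e).
Proof.
  intros hV hT [k hk] hg hgw hbr.
  destruct (branching_edge hV hT g hg hgw hbr)
    as [e [t1 [t2 [s [ho [h1 [h2 [h3 [h4 [h5 [h6 h7]]]]]]]]]]].
  split; [now apply (@ping_pong_infinite G V T hV e t1 t2)|].
  exists e. split; auto. intros H hH hHV hc.
  assert (hHs := fin_generated_sub hH).
  apply (@escape_double_finite G V T hV hT e s); auto.
  destruct hc as [[N [n1 [n2 [n3 n4]]]]|[C [c1 [c2 [c3 c4]]]]].
  - now apply (@escape_normal G V T hV hT e t1 t2 k) with N.
  - now apply (@escape_double G V T hV hT e t1 t2 k) with C.
Qed.

(** * The inductive step *)

(** With this as its last argument, [double_finite] expresses finite index. *)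
Definition one_sub (G : group) (x : G) : Prop := x = gone.
Arguments one_sub {G}.

(** The normal subgroup alternative is what the theorem needs; the double coset alternative lets the
    property pass from a vertex stabilizer to the whole group. *)
Definition rigid (G : group) (V : G -> Prop) : Prop :=
  (~ exists l : list G, forall x, V x -> In x l) /\
  forall H : G -> Prop, fin_generated H -> (forall x, H x -> V x) ->
    has_normal_subgroup V H \/ cyclic_double_finite V H -> double_finite V H one_sub.
Arguments rigid {G}.

Lemma rigid_vertex_double_finite (G : group) (V : G -> Prop) (T : tree_action G V) e H :
  is_subgroup V -> is_tree T -> (forall a, is_cyclic (estab T a)) ->
  rigid (vstab T (torig T e)) ->
  fin_generated H -> (forall x, H x -> V x) ->
  double_finite V H (estab T e) -> double_finite V H one_sub.
Proof.
  intros hV hT hcyc [_ hrig] hH hHV [l [hl hdf]].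
  set (w := torig T e) in *.
  assert (hHs := fin_generated_sub hH).
  assert (hev : forall c, estab T e c -> vstab T w c) by (intro; apply estab_vstab).
  assert (hev' := vstab_sub T hV w).
  (* The stabilizer of [e] lies in that of [w], so it is enough to cover the [r]-translate of the
     latter by finitely many cosets of [H]. *)
  assert (hmain : forall r, V r -> exists m, (forall y, In y m -> V y) /\
    forall x, vstab T w x -> exists h y, H h /\ In y m /\ r ** x = h ** y).
  { intros r hr.
    assert (hrV : V r^-1) by now apply subV.
    assert (hHr := fin_generated_conj r hH).
    assert (hHrs := fin_generated_sub hHr).
    set (Hr := fun x => H (r ** x ** r^-1)) in *.
    assert (hHrV : forall x, Hr x -> V x).
    { intros x hx. replace x with (r^-1 ** (r ** x ** r^-1) ** r) by grp.
      apply subM; auto. apply subM; auto. }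
    assert (hK : fin_generated (fun x => Hr x /\ vstab T w x)).
    { destruct hHr as [F hF]. apply (@vstab_fin_generated G V T hV hT Hr F w hHrV hF).
      intro a. apply (cyclic_subgroup_fg (hcyc a)); [|tauto].
      apply subI; auto. now apply estab_sub. }
    (* The elements [r^-1 ** r'] need not fix [w]; each is replaced by an element [y'] of its coset
       of [Hr] that does, when there is one. *)
    destruct (list_choice (fun y y' => vstab T w y' /\ Hr (y' ** y^-1)) (map (gmul r^-1) l))
      as [m [hm1 hm2]].
    destruct (hrig (fun x => Hr x /\ vstab T w x)) as [n [hn1 hn2]]; auto.
    { tauto. }
    { right. exists (estab T e). split; [now apply estab_sub|]. split; [auto|]. split; [auto|].
      exists m. split.
      { intros y' hy'. now destruct (hm1 y' hy') as [_ [_ [h _]]]. }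
      intros x hx.
      destruct (hdf (r ** x)) as [h [r' [c [hh [hr' [hc E]]]]]]; [apply subM; auto; apply hx|].
      assert (hxc : vstab T w (x ** c^-1)) by (apply subM; auto; apply subV; auto).
      assert (exc : Hr ((x ** c^-1) ** (r^-1 ** r')^-1)).
      { unfold Hr. replace (r ** (x ** c^-1 ** (r^-1 ** r')^-1) ** r^-1) with h; auto.
        rewrite <- (gmulVK _ r x), E. grp. }
      destruct (hm2 (r^-1 ** r')) as [y' [hy' [h1 h2]]].
      { now apply in_map. }
      { eauto. }
      exists (x ** c^-1 ** y'^-1), y', c. split; [|split; [auto|split; [auto|grp]]].
      split.
      - replace (x ** c^-1 ** y'^-1)
          with ((x ** c^-1 ** (r^-1 ** r')^-1) ** (y' ** (r^-1 ** r')^-1)^-1) by grp.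
        apply subM; auto. now apply subV.
      - apply subM; auto. now apply subV. }
    exists (map (gmul r) n). split.
    { intros y hy. apply in_map_iff in hy as [z [<- hz]]. apply subM; auto. now apply hn1. }
    intros x hx. destruct (hn2 x hx) as [h [y [c [[h1 h2] [h3 [h4 E]]]]]].
    exists (r ** h ** r^-1), (r ** y). split; [auto|split; [now apply in_map|]].
    rewrite E, h4. grp. }
  destruct (list_choice (fun r m => (forall y, In y m -> V y) /\
    forall x, vstab T w x -> exists h y, H h /\ In y m /\ r ** x = h ** y) l)
    as [M [hM1 hM2]].
  exists (concat M). split.
  - intros y hy. apply in_concat in hy as [m [hm hy]].
    destruct (hM1 m hm) as [_ [_ [h _]]]. auto.
  - intros x hx. destruct (hdf x hx) as [h [r [c [hh [hr [hc E]]]]]].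
    destruct (hM2 r hr) as [m [hm [_ hm']]]; [apply hmain; auto|].
    destruct (hm' c (hev c hc)) as [h' [y [hh' [hy E']]]].
    exists (h ** h'), y, gone. split; [now apply subM|].
    split; [apply in_concat; eauto|]. split; [reflexivity|].
    rewrite E, gmul_assoc_r, E'. grp.
Qed.

Lemma one_sub_fin_generated (G : group) : fin_generated (@one_sub G).
Proof.
  exists []. intro x. split.
  - intros ->. apply sub1, gen_sub.
  - intro hx. apply hx; [apply sub_trivial | now intros y []].
Qed.

(** Rigidity applied to the trivial subgroup would make [V] finite. *)
Lemma rigid_not_near_cyclic (G : group) (V C : G -> Prop) : is_subgroup V -> is_subgroup C ->
  is_cyclic C -> (forall x, C x -> V x) -> rigid V -> ~ double_finite V one_sub C.
Proof.
  intros hV hC hCc hCV [hinf hrig] hdf. apply hinf.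
  destruct (hrig one_sub) as [l [_ hl]].
  - apply one_sub_fin_generated.
  - intros x ->. now apply sub1.
  - right. now exists C.
  - exists l. intros x hx. destruct (hl x hx) as [h [r [c [-> [hr [-> ->]]]]]].
    now autorewrite with grp.
Qed.

(** Otherwise [e] has at most two translates under the vertex stabilizer, in which the cyclic edge
    stabilizer would have index at most two. *)
Lemma rigid_vertex_branches (G : group) (V : G -> Prop) (T : tree_action G V) e :
  is_subgroup V -> is_cyclic (estab T e) -> rigid (vstab T (torig T e)) ->
  exists s1 s2, vstab T (torig T e) s1 /\ vstab T (torig T e) s2 /\
    actE T s1 e <> e /\ actE T s2 e <> e /\ actE T s1 e <> actE T s2 e.
Proof.
  intros hV hcyc hrig. set (w := torig T e) in *.
  assert (hev : forall c, estab T e c -> vstab T w c) by (intro; apply estab_vstab).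
  assert (hw := vstab_sub T hV w). assert (he := estab_sub T hV e).
  apply NNPP. intro hno.
  apply (@rigid_not_near_cyclic G (vstab T w) (estab T e)); auto.
  assert (hcoset : forall r x, vstab T w r -> vstab T w x -> actE T r e = actE T x e ->
    exists h r' c, one_sub h /\ r' = r /\ estab T e c /\ x = h ** r' ** c).
  { intros r x hr hx E. exists gone, r, (r^-1 ** x). repeat split; auto; [..|grp].
    - apply subM; auto; [apply subV; auto; apply hr | apply hx].
    - rewrite actEM, <- E; [|apply subV; auto; apply hr | apply hx].
      apply (ae_invK T hV). apply hr. }
  destruct (classic (exists s, vstab T w s /\ actE T s e <> e)) as [[s [hs hse]]|hno'].
  - exists [gone; s]. split.
    { intros r [<-|[<-|[]]]; auto. now apply sub1. }
    intros x hx. destruct (classic (actE T x e = e)) as [E|E].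
    + destruct (hcoset gone x) as [h [r [c [h1 [h2 [h3 h4]]]]]]; auto.
      { now apply sub1. }
      { now rewrite actE1. }
      exists h, r, c. repeat split; auto; try apply h3. now left.
    + destruct (hcoset s x) as [h [r [c [h1 [h2 [h3 h4]]]]]]; auto.
      { apply NNPP. intro hne. apply hno. now exists s, x. }
      exists h, r, c. repeat split; auto; try apply h3. right. now left.
  - exists [gone]. split.
    { intros r [<-|[]]; auto. now apply sub1. }
    intros x hx. destruct (hcoset gone x) as [h [r [c [h1 [h2 [h3 h4]]]]]]; auto.
    { now apply sub1. }
    { rewrite actE1. apply NNPP. intro hne. apply hno'. exists x. auto. }
    exists h, r, c. repeat split; auto; try apply h3. now left.
Qed.

Lemma rigid_of_vertex (G : group) (V : G -> Prop) (T : tree_action G V) w :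
  is_subgroup V -> is_tree T -> acylindrical T -> (forall e, is_cyclic (estab T e)) ->
  rigid (vstab T w) -> rigid V.
Proof.
  intros hV hT hac hcyc hrig.
  destruct (classic (exists g, V g /\ actV T g w <> w)) as [[g [hg hgw]]|hno].
  - destruct (@irreducible_tree_double_finite G V T w g) as [hinf [e [<- he]]]; auto.
    { intros e <-. now apply rigid_vertex_branches. }
    split; auto. intros H hH hHV hc.
    apply (@rigid_vertex_double_finite G V T e); auto.
  - replace V with (vstab T w); auto.
    extensionality g. apply propositional_extensionality. split; [now intros []|].
    intro hg. split; auto. apply NNPP. eauto.
Qed.

(** * The Bass-Serre tree of a free product *)

Section Permutations.
Variable X : Type.

(** A permutation is stored with its inverse, so that inversion swaps components. *)
Definition perm : Type :=
  {p : (X -> X) * (X -> X) | (forall x, fst p (snd p x) = x) /\ forall x, snd p (fst p x) = x}.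

Lemma perm_eq (p q : perm) : fst (proj1_sig p) = fst (proj1_sig q) ->
  snd (proj1_sig p) = snd (proj1_sig q) -> p = q.
Proof.
  destruct p as [[p1 p2] hp], q as [[q1 q2] hq]. simpl. intros -> ->.
  f_equal. apply proof_irrelevance.
Qed.

Definition perm_mul (p q : perm) : perm.
Proof.
  exists (fun x => fst (proj1_sig p) (fst (proj1_sig q) x),
          fun x => snd (proj1_sig q) (snd (proj1_sig p) x)).
  destruct p as [[p1 p2] [hp hp']], q as [[q1 q2] [hq hq']]; simpl in *.
  split; intro x; [now rewrite hq, hp | now rewrite hp', hq'].
Defined.

Definition perm_inv (p : perm) : perm.
Proof.
  exists (snd (proj1_sig p), fst (proj1_sig p)).
  destruct p as [[p1 p2] [hp hp']]; simpl in *. now split.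
Defined.

Definition perm_one : perm.
Proof. now exists (fun x => x, fun x => x). Defined.

Definition perm_group : group.
Proof.
  apply (@Group perm perm_mul perm_one perm_inv).
  - intros p q r. now apply perm_eq.
  - intro p. now apply perm_eq.
  - intro p. apply perm_eq; simpl; extensionality x; destruct p as [[p1 p2] [hp hp']]; simpl in *; auto.
Defined.
End Permutations.

(** * Reduced words and normal forms in a free product *)

Section FreeProduct.
Variables (G : group) (H A B : G -> Prop).
Hypothesis hfp : free_product_of H A B.

Definition factor (b : bool) : G -> Prop := if b then A else B.

Lemma factor_sub b : is_subgroup (factor b).
Proof. destruct hfp as [h1 [h2 _]]. now destruct b. Qed.

Lemma factor_in b x : factor b x -> H x.
Proof. destruct hfp as [_ [_ [h1 [h2 _]]]]. destruct b; simpl; auto. Qed.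

Lemma free_product_gen x : H x <-> gen (fun y => exists b, factor b y) x.
Proof.
  destruct hfp as [_ [_ [_ [_ [h _]]]]]. rewrite h. split; apply gen_mono.
  - intros y [hy|hy]; [now exists true | now exists false].
  - intros y [[|] hy]; auto.
Qed.

Lemma free_product_sub : is_subgroup H.
Proof.
  destruct (@gen_sub G (fun y => exists b, factor b y)) as [h1 [h2 h3]].
  repeat split.
  - now apply free_product_gen.
  - intros x y hx hy. apply free_product_gen. apply h2; now apply free_product_gen.
  - intros x hx. apply free_product_gen. apply h3. now apply free_product_gen.
Qed.

Definition tagged (b : bool) (l : list (bool * G)) : Prop :=
  match l with [] => False | (b', _) :: _ => b' = b end.

Fixpoint reduced (l : list (bool * G)) : Prop :=
  match l with
  | [] => True
  | (b, x) :: l' => factor b x /\ x <> gone /\ ~ tagged b l' /\ reduced l'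
  end.

Definition value (l : list (bool * G)) : G :=
  fold_right (fun p y => snd p ** y) gone l.

Lemma value_in l : reduced l -> H (value l).
Proof.
  induction l as [|[b x] l IH]; simpl; [intros _; apply sub1, free_product_sub|].
  intros [h1 [_ [_ h2]]]. apply subM; [apply free_product_sub | now apply (factor_in b) | auto].
Qed.

Definition split_word (b : bool) (l : list (bool * G)) : G * list (bool * G) :=
  match l with
  | (b', x) :: l' => if Bool.eqb b' b then (x, l') else (gone, l)
  | [] => (gone, [])
  end.

Definition push (b : bool) (x : G) (l : list (bool * G)) : list (bool * G) :=
  if excluded_middle_informative (x = gone) then l else (b, x) :: l.

(** Van der Waerden's action: [g] multiplies the leading syllable of type [b], or the identity if
    there is none, and a trivial product disappears. *)
Definition word_act (b : bool) (g : G) (l : list (bool * G)) : list (bool * G) :=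
  push b (g ** fst (split_word b l)) (snd (split_word b l)).

Lemma push_one b l : push b gone l = l.
Proof. unfold push. now destruct (excluded_middle_informative (gone = gone)). Qed.

Lemma push_ne b x l : x <> gone -> push b x l = (b, x) :: l.
Proof. intro h. unfold push. now destruct (excluded_middle_informative (x = gone)). Qed.

Lemma split_untagged b l : ~ tagged b l -> split_word b l = (gone, l).
Proof.
  destruct l as [|[b' x] l]; simpl; auto. intro h.
  destruct (Bool.eqb_spec b' b); easy.
Qed.

Lemma split_push b x l : ~ tagged b l -> split_word b (push b x l) = (x, l).
Proof.
  intro h. destruct (classic (x = gone)) as [->|hx].
  - rewrite push_one. now apply split_untagged.
  - rewrite push_ne by auto. simpl. now rewrite Bool.eqb_reflx.
Qed.

Lemma split_spec b l : reduced l ->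
  factor b (fst (split_word b l)) /\ reduced (snd (split_word b l)) /\
  ~ tagged b (snd (split_word b l)) /\ push b (fst (split_word b l)) (snd (split_word b l)) = l.
Proof.
  assert (h1 := sub1 (factor_sub b)).
  destruct l as [|[b' x] l]; simpl.
  - rewrite push_one. tauto.
  - intros [h2 [h3 [h4 h5]]]. destruct (Bool.eqb_spec b' b) as [->|hne]; simpl.
    + rewrite push_ne; auto.
    + rewrite push_one. repeat split; auto.
Qed.

Lemma push_reduced b x l : factor b x -> ~ tagged b l -> reduced l -> reduced (push b x l).
Proof.
  intros h1 h2 h3. destruct (classic (x = gone)) as [->|hx].
  - now rewrite push_one.
  - now rewrite push_ne.
Qed.

Lemma word_act_reduced b g l : factor b g -> reduced l -> reduced (word_act b g l).
Proof.
  intros hg hl. destruct (split_spec b l hl) as [h1 [h2 [h3 _]]].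
  apply push_reduced; auto. apply subM; auto. apply factor_sub.
Qed.

Lemma word_actM b g h l : reduced l ->
  word_act b g (word_act b h l) = word_act b (g ** h) l.
Proof.
  intro hl. destruct (split_spec b l hl) as [_ [_ [h3 _]]].
  unfold word_act at 1. unfold word_act at 1 2. rewrite split_push by auto. simpl.
  unfold word_act. now rewrite gmulA.
Qed.

Lemma word_act1 b l : reduced l -> word_act b gone l = l.
Proof.
  intro hl. destruct (split_spec b l hl) as [_ [_ [_ h]]].
  unfold word_act. now rewrite gmul1l.
Qed.

Definition word : Type := {l : list (bool * G) | reduced l}.

Lemma word_eq (u v : word) : proj1_sig u = proj1_sig v -> u = v.
Proof. destruct u, v. simpl. intros ->. f_equal. apply proof_irrelevance. Qed.

Definition word_map b g (hg : factor b g) (u : word) : word :=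
  exist _ (word_act b g (proj1_sig u)) (word_act_reduced b g _ hg (proj2_sig u)).

Definition word_perm b g (hg : factor b g) : perm_group word.
Proof.
  exists (word_map b g hg, word_map b g^-1 (subV _ (factor_sub b) hg)).
  split; intros [l hl]; apply word_eq; simpl; rewrite word_actM by auto;
    [rewrite gmulVr | rewrite gmulVl]; now apply word_act1.
Defined.

(** Outside the factor the value is a default, since the universal property takes functions on all
    of [G]. *)
Definition factor_action b (g : G) : perm_group word :=
  match excluded_middle_informative (factor b g) with
  | left hg => word_perm b g hg
  | right _ => gone
  end.

Lemma factor_action_val b g (u : word) : factor b g ->
  proj1_sig (fst (proj1_sig (factor_action b g)) u) = word_act b g (proj1_sig u).
Proof.
  intro hg. unfold factor_action.
  now destruct (excluded_middle_informative (factor b g)).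
Qed.

Lemma factor_action_inv_val b g (u : word) : factor b g ->
  proj1_sig (snd (proj1_sig (factor_action b g)) u) = word_act b g^-1 (proj1_sig u).
Proof.
  intro hg. unfold factor_action.
  now destruct (excluded_middle_informative (factor b g)).
Qed.

Lemma factor_action_hom b : hom_on (factor b) (factor_action b).
Proof.
  intros x y hx hy.
  assert (hxy : factor b (x ** y)) by (apply subM; auto; apply factor_sub).
  apply perm_eq; extensionality u; apply word_eq; simpl.
  - rewrite !factor_action_val by auto. symmetry. apply word_actM, proj2_sig.
  - rewrite !factor_action_inv_val, ginvM by auto. symmetry. apply word_actM, proj2_sig.
Qed.

(** The universal property merges the two actions into one of [H], under which the value of a
    reduced word takes the empty word to that word. An element of the other factor takes it to at
    most one syllable, of the other type. *)
Lemma normal_form b x l : reduced ((b, x) :: l) -> ~ factor (negb b) (value ((b, x) :: l)).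
Proof.
  intros hred hval.
  destruct hfp as [_ [_ [_ [_ [_ huniv]]]]].
  destruct (huniv (perm_group word) (factor_action true) (factor_action false))
    as [phi [hphi [hA hB]]]; [apply (factor_action_hom true) | apply (factor_action_hom false)|].
  assert (hphib : forall b' g, factor b' g -> phi g = factor_action b' g).
  { intros [|] g hg; auto. }
  pose (empty := exist _ [] I : word).
  assert (hone : phi gone = gone).
  { assert (E := hphi gone gone (sub1 free_product_sub) (sub1 free_product_sub)).
    rewrite gmul1l in E. apply (gmul_cancel_l _ (phi gone)). now rewrite <- E, gmul1r. }
  assert (hnf : forall l', reduced l' -> proj1_sig (fst (proj1_sig (phi (value l'))) empty) = l').
  { induction l' as [|[b' y] l' IH]; intro h.
    - simpl. now rewrite hone.
    - assert (h' := h). destruct h' as [h1 [h2 [h3 h4]]]. simpl value.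
      rewrite hphi by (try apply value_in; auto; now apply (factor_in b')).
      simpl. rewrite (hphib b' y h1), factor_action_val, IH by auto.
      unfold word_act. rewrite split_untagged by auto. simpl.
      now rewrite gmul1r, push_ne. }
  assert (E := hnf _ hred). rewrite (hphib _ _ hval), factor_action_val in E by auto.
  simpl in E. unfold word_act in E. simpl in E.
  unfold push in E. destruct (excluded_middle_informative _); [easy|].
  injection E as E _ _. now destruct b.
Qed.

Lemma factors_meet b x : factor b x -> factor (negb b) x -> x = gone.
Proof.
  intros h1 h2. apply NNPP. intro hx.
  apply (@normal_form b x []); simpl; auto. now rewrite gmul1r.
Qed.

(** * The tree of cosets *)

Definition coset_vertex (b : bool) (x : G) : bool * (G -> Prop) :=
  (b, fun y => factor b (x^-1 ** y)).

Definition bs_vertex : Type :=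
  {v : bool * (G -> Prop) | exists x, H x /\ v = coset_vertex (fst v) x}.

Lemma bs_vertex_eq (u v : bs_vertex) : proj1_sig u = proj1_sig v -> u = v.
Proof. destruct u, v. simpl. intros ->. f_equal. apply proof_irrelevance. Qed.

Definition vx b x (hx : H x) : bs_vertex :=
  exist _ (coset_vertex b x) (ex_intro _ x (conj hx eq_refl)).
Arguments vx : clear implicits.

Lemma vx_eq b b' x y hx hy : vx b x hx = vx b' y hy <-> b = b' /\ factor b (x^-1 ** y).
Proof.
  split.
  - intro E. apply (f_equal (@proj1_sig _ _)) in E. simpl in E. unfold coset_vertex in E.
    injection E as Eb E. subst b'. split; auto.
    apply (f_equal (fun P => P y)) in E. rewrite E, gmulVl. apply sub1, factor_sub.
  - intros [<- h]. apply bs_vertex_eq. simpl. unfold coset_vertex. f_equal.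
    extensionality z. apply propositional_extensionality. split; intro h'.
    + replace (y^-1 ** z) with ((x^-1 ** y)^-1 ** (x^-1 ** z)) by grp.
      apply subM; auto using factor_sub. apply subV; auto using factor_sub.
    + replace (x^-1 ** z) with ((x^-1 ** y) ** (y^-1 ** z)) by grp.
      apply subM; auto using factor_sub.
Qed.

Lemma vx_surj v : exists b x hx, v = vx b x hx.
Proof.
  destruct v as [[b P] [x [hx E]]]. exists b, x, hx. now apply bs_vertex_eq.
Qed.

(** Elements outside [H] act trivially by default; the action laws concern [H] only. *)
Definition bs_actV (g : G) (v : bs_vertex) : bs_vertex.
Proof.
  destruct (excluded_middle_informative (H g)) as [hg|_]; [|exact v].
  exists (fst (proj1_sig v), fun y => snd (proj1_sig v) (g^-1 ** y)).
  destruct v as [[b P] [x [hx E]]]. simpl in *. injection E as ->.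
  exists (g ** x). split; [apply subM; auto using free_product_sub|].
  unfold coset_vertex. f_equal. extensionality y. now autorewrite with grp.
Defined.

Lemma bs_actV_vx g b x hx (hg : H g) :
  bs_actV g (vx b x hx) = vx b (g ** x) (subM _ _ free_product_sub hg hx).
Proof.
  apply bs_vertex_eq. unfold bs_actV.
  destruct (excluded_middle_informative (H g)) as [hg'|h]; [|easy].
  simpl. unfold coset_vertex. f_equal. extensionality y. now autorewrite with grp.
Qed.

Definition bs_edge : Type := ({x : G | H x} * bool)%type.

Definition bs_actE (g : G) (e : bs_edge) : bs_edge :=
  match excluded_middle_informative (H g) with
  | left hg => (exist _ (g ** proj1_sig (fst e))
                 (subM _ _ free_product_sub hg (proj2_sig (fst e))), snd e)
  | right _ => e
  end.

Lemma bs_edge_eq (e f : bs_edge) :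
  proj1_sig (fst e) = proj1_sig (fst f) -> snd e = snd f -> e = f.
Proof.
  destruct e as [[x hx] b], f as [[y hy] c]. simpl. intros -> ->.
  do 2 f_equal. apply proof_irrelevance.
Qed.

Lemma bs_actE_val g e : H g -> proj1_sig (fst (bs_actE g e)) = g ** proj1_sig (fst e).
Proof. intro hg. unfold bs_actE. now destruct (excluded_middle_informative (H g)). Qed.

Lemma bs_actE_side g e : snd (bs_actE g e) = snd e.
Proof. unfold bs_actE. now destruct (excluded_middle_informative (H g)). Qed.

Definition bs_orig (e : bs_edge) : bs_vertex := vx (snd e) (proj1_sig (fst e)) (proj2_sig (fst e)).
Definition bs_bar (e : bs_edge) : bs_edge := (fst e, negb (snd e)).

(** [x] is an edge joining the cosets [x A] and [x B]; its boolean tells at which of them it starts. *)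
Definition bs_tree : tree_action G H.
Proof.
  assert (hH := free_product_sub).
  refine (@TreeAction G H bs_vertex bs_edge bs_orig bs_bar _ _ bs_actV bs_actE _ _ _ _ _ _ _).
  - intros [x b]. unfold bs_bar. simpl. now rewrite Bool.negb_involutive.
  - intros [x b] E. injection E as E. now destruct b.
  - intro v. destruct (vx_surj v) as [b [x [hx ->]]].
    rewrite (bs_actV_vx _ _ (sub1 hH)). apply vx_eq. split; auto.
    autorewrite with grp. apply sub1, factor_sub.
  - intro e. apply bs_edge_eq; [|now rewrite bs_actE_side].
    rewrite bs_actE_val by now apply sub1. apply gmul1l.
  - intros g h v hg hh. destruct (vx_surj v) as [b [x [hx ->]]].
    rewrite (bs_actV_vx _ _ (subM _ _ hH hg hh)), (bs_actV_vx _ _ hh), (bs_actV_vx _ _ hg).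
    apply vx_eq. split; auto. autorewrite with grp. apply sub1, factor_sub.
  - intros g h e hg hh. apply bs_edge_eq.
    + rewrite !bs_actE_val by (auto; now apply subM). now autorewrite with grp.
    + now rewrite !bs_actE_side.
  - intros g e hg. unfold bs_orig. rewrite (bs_actV_vx _ _ hg). apply vx_eq.
    rewrite bs_actE_side. split; auto. rewrite bs_actE_val by auto.
    autorewrite with grp. apply sub1, factor_sub.
  - intros g e hg. apply bs_edge_eq.
    + simpl. rewrite !bs_actE_val by auto. reflexivity.
    + simpl. now rewrite !bs_actE_side.
  - intros g e hg E. apply (f_equal snd) in E. rewrite bs_actE_side in E. simpl in E.
    now destruct (snd e).
Defined.

Lemma bs_connected u v : conn bs_tree (fun _ => True) u v.
Proof.
  assert (hH := free_product_sub).
  assert (hsym : forall u v, conn bs_tree (fun _ => True) u v -> conn bs_tree (fun _ => True) v u).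
  { intros u' v'. now apply conn_sym. }
  assert (hedge : forall b b' x hx hx',
    conn bs_tree (fun _ => True) (vx b x hx) (vx b' x hx')).
  { intros b b' x hx hx'. rewrite (proof_irrelevance _ hx' hx).
    destruct (Bool.bool_dec b b') as [<-|hne]; [apply conn_refl|].
    replace b' with (negb b) by now destruct b, b'.
    exact (conn_edge bs_tree (fun _ => True) ((exist _ x hx, b) : bs_edge) I). }
  assert (hgen : forall y, H y -> H y /\ forall b x hx hxy,
    conn bs_tree (fun _ => True) (vx b x hx) (vx b (x ** y) hxy)).
  { intros y hy. apply free_product_gen in hy. pattern y. apply hy; clear y hy.
    - split; [|split].
      + split; [now apply sub1|]. intros b x hx hxy.
        replace (vx b (x ** gone) hxy) with (vx b x hx); [apply conn_refl|].
        apply vx_eq. split; auto. autorewrite with grp. apply sub1, factor_sub.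
      + intros y z [hy ey] [hz ez]. split; [now apply subM|]. intros b x hx hxyz.
        assert (hxy : H (x ** y)) by now apply subM.
        apply conn_trans with (1 := ey b x hx hxy).
        assert (hxyz' : H (x ** y ** z)) by now apply subM.
        replace (vx b (x ** (y ** z)) hxyz) with (vx b (x ** y ** z) hxyz'); [apply ez|].
        apply vx_eq. split; auto. autorewrite with grp. apply sub1, factor_sub.
      + intros y [hy ey]. split; [now apply subV|]. intros b x hx hxy. apply hsym.
        assert (hxy' : H (x ** y^-1 ** y)) by (autorewrite with grp; auto).
        replace (vx b x hx) with (vx b (x ** y^-1 ** y) hxy'); [apply ey|].
        apply vx_eq. split; auto. autorewrite with grp. apply sub1, factor_sub.
    - intros y [c hy]. assert (hyH := factor_in _ _ hy). split; auto. intros b x hx hxy.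
      apply conn_trans with (1 := hedge b c x hx hx).
      replace (vx c x hx) with (vx c (x ** y) hxy); [apply hedge|].
      symmetry. apply vx_eq. split; auto. now autorewrite with grp. }
  destruct (vx_surj u) as [b [x [hx ->]]], (vx_surj v) as [b' [x' [hx' ->]]].
  assert (hz : H (x^-1 ** x')) by (apply subM; auto; now apply subV).
  assert (hxz : H (x ** (x^-1 ** x'))) by now apply subM.
  apply conn_trans with (1 := proj2 (hgen _ hz) b x hx hxz).
  apply conn_trans with (1 := hedge b b' _ hxz hxz).
  replace (vx b' x' hx') with (vx b' (x ** (x^-1 ** x')) hxz); [apply conn_refl|].
  apply vx_eq. split; auto. autorewrite with grp. apply sub1, factor_sub.
Qed.

(** Successive edges at a common vertex differ by an element of its factor, which is nontrivial
    without backtracking; these elements are the syllables. *)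
Lemma bs_reduced_path_word l : forall e : bs_edge, is_reduced_path bs_tree (e :: l) ->
  exists w, reduced w /\ (l = [] /\ w = [] \/ tagged (negb (snd e)) w) /\
    proj1_sig (fst (last l e)) = proj1_sig (fst e) ** value w.
Proof.
  induction l as [|f l IH]; intros e hl.
  - exists []. simpl. rewrite gmul1r. auto.
  - destruct hl as [h1 [h2 h3]].
    destruct (IH f h3) as [w [hw1 [hw2 hw3]]].
    change (vx (negb (snd e)) (proj1_sig (fst e)) (proj2_sig (fst e)) =
            vx (snd f) (proj1_sig (fst f)) (proj2_sig (fst f))) in h1.
    apply vx_eq in h1 as [hb hy]. change (f <> bs_bar e) in h2.
    rewrite last_cons, hw3. set (y := (proj1_sig (fst e))^-1 ** proj1_sig (fst f)) in *.
    exists ((negb (snd e), y) :: w). simpl. rewrite <- hb in *.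
    split; [|split; auto].
    + repeat split; auto.
      * intro hy1. apply h2. apply bs_edge_eq; simpl; auto.
        rewrite <- (gmulKV _ (proj1_sig (fst e)) (proj1_sig (fst f))). fold y. now rewrite hy1, gmul1r.
      * destruct hw2 as [[_ ->]|hw2]; [easy|]. rewrite Bool.negb_involutive in hw2.
        destruct w as [|[c z] w]; [easy|]. simpl in *. subst c. now destruct (snd e).
    + unfold y. now autorewrite with grp.
Qed.

(** A closed reduced path of at least two edges spells a reduced word whose value lies in the factor
    opposite to its first syllable, against [normal_form]. *)
Lemma bs_is_tree : is_tree bs_tree.
Proof.
  assert (hH := free_product_sub). split; [|split].
  - exact (inhabits (vx true gone (sub1 hH))).
  - intros u v. destruct (conn_reduced (bs_connected u v)) as [->|[l [h1 [h2 _]]]]; auto.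
    right. exists l. split; auto. now apply reduced_is_path.
  - intros l v hl hp. destruct l as [|e l]; [easy|]. destruct hp as [ho ht].
    rewrite last_cons in ht. rewrite <- ho in ht.
    destruct (bs_reduced_path_word l e hl) as [w [hw1 [hw2 hw3]]].
    set (f := last l e) in *.
    change (vx (negb (snd f)) (proj1_sig (fst f)) (proj2_sig (fst f)) =
            vx (snd e) (proj1_sig (fst e)) (proj2_sig (fst e))) in ht.
    apply vx_eq in ht as [hb hy]. destruct hw2 as [[-> _]|hw2].
    + simpl in f. subst f. now destruct (snd e).
    + destruct w as [|[c z] w]; [easy|]. simpl in hw2. subst c.
      apply (normal_form hw1). rewrite Bool.negb_involutive. rewrite hb in hy.
      replace (value ((negb (snd e), z) :: w))
        with (((proj1_sig (fst f))^-1 ** proj1_sig (fst e))^-1).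
      * apply subV; [apply factor_sub|exact hy].
      * change (proj1_sig (fst f) = proj1_sig (fst e) ** value ((negb (snd e), z) :: w)) in hw3.
        rewrite hw3. now autorewrite with grp.
Qed.

Lemma bs_estab (e : bs_edge) g : estab bs_tree e g -> g = gone.
Proof.
  intros [hg he]. apply (f_equal (fun e : bs_edge => proj1_sig (fst e))) in he.
  simpl in he. rewrite bs_actE_val in he by auto.
  rewrite <- (gmul1r _ g), <- (gmulVr _ (proj1_sig (fst e))), gmulA, he. reflexivity.
Qed.

Lemma bs_acylindrical : acylindrical bs_tree.
Proof.
  exists 0. intros [|e l] _ hlen g hg hfix; [simpl in hlen; lia|].
  apply (@bs_estab e). split; auto. apply hfix. now left.
Qed.

Lemma free_product_rigid b : at_least_three (factor b) -> nontrivial (factor (negb b)) -> rigid H.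
Proof.
  intros [p1 [p2 [p3 [hp1 [hp2 [hp3 [n12 [n23 n13]]]]]]]] [g [hg hg1]].
  assert (hH := free_product_sub). assert (hS := factor_sub b).
  assert (hgH := factor_in _ _ hg).
  set (w := vx b gone (sub1 hH) : tV bs_tree).
  destruct (@irreducible_tree_double_finite G H bs_tree w g) as [hinf [e [_ he]]]; auto.
  - apply bs_is_tree.
  - apply bs_acylindrical.
  - change (bs_actV g w <> w). unfold w. rewrite (bs_actV_vx _ _ hgH). intro E.
    apply vx_eq in E as [_ E]. autorewrite with grp in E. apply hg1.
    apply (factors_meet b); auto. rewrite <- (ginvK _ g). now apply subV.
  - intros [[x hx] c] ho. apply vx_eq in ho as [hc hxb]. simpl in hc, hxb. subst c.
    rewrite gmul1r in hxb.
    assert (hxb' : factor b x) by (rewrite <- (ginvK _ x); now apply subV).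
    (* At most one of the three elements equals [x]; two others give the two rotations of the
       edge. *)
    assert (hex : exists y1 y2, factor b y1 /\ factor b y2 /\ y1 <> x /\ y2 <> x /\ y1 <> y2).
    { destruct (classic (p1 = x)) as [->|]; [now exists p2, p3; repeat split; auto|].
      destruct (classic (p2 = x)) as [->|]; [now exists p1, p3; repeat split; auto|].
      now exists p1, p2; repeat split; auto. }
    destruct hex as [y1 [y2 [hy1 [hy2 [m1 [m2 m12]]]]]].
    assert (hst : forall y, factor b y -> vstab bs_tree w (y ** x^-1)).
    { intros y hy. assert (h : factor b (y ** x^-1)) by (apply subM; auto).
      assert (hyH := factor_in _ _ h). split; auto.
      change (bs_actV (y ** x^-1) w = w). unfold w. rewrite (bs_actV_vx _ _ hyH). apply vx_eq.
      split; auto. rewrite !gmul1r. now apply subV. }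
    assert (hact : forall y hy, factor b y -> bs_actE (y ** x^-1) (exist _ x hx, b) = (exist _ y hy, b)).
    { intros y hyH hy. apply bs_edge_eq; [|now rewrite bs_actE_side].
      rewrite bs_actE_val; [simpl; now autorewrite with grp|].
      apply subM; auto. now apply subV. }
    exists (y1 ** x^-1), (y2 ** x^-1). split; [auto|]. split; [auto|]. simpl.
    rewrite (hact y1 (factor_in _ _ hy1) hy1), (hact y2 (factor_in _ _ hy2) hy2).
    repeat split; intro E; injection E; auto.
  - split; auto. intros K hK hKH hc.
    destruct (he K hK hKH hc) as [l [hl1 hl2]]. exists l. split; auto.
    intros x hx. destruct (hl2 x hx) as [h [r [c [h1 [h2 [h3 h4]]]]]].
    exists h, r, c. repeat split; auto. now apply (@bs_estab e).
Qed.

End FreeProduct.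

(** * Rigidity of the class and finite index *)

Lemma classC_n_rigid (G : group) n : forall V : G -> Prop, is_subgroup V -> classC_n n V -> rigid V.
Proof.
  induction n as [|n IH]; intros V hV hc.
  - destruct hc as [A [B [hfp [hA [hB [_ [_ [h|h]]]]]]]].
    + exact (free_product_rigid hfp true h hB).
    + exact (free_product_rigid hfp false h hA).
  - destruct hc as [T [hT [_ [hac [_ [hcyc [v hv]]]]]]].
    apply (@rigid_of_vertex G V T v); auto.
    apply IH; auto. now apply vstab_sub.
Qed.

Theorem theorem4p1 (Gamma : group) (N G : Gamma -> Prop) :
  in_class_C Gamma ->
  is_subgroup N -> is_subgroup G ->
  is_normal N -> (forall x, N x -> G x) ->
  nontrivial N ->
  fin_generated G ->
  finite_index G.
Proof.
  intros [n hn] hN hG hnorm hNG hnt hfg.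
  destruct (@classC_n_rigid Gamma n (fun _ => True)) as [_ hrig]; auto.
  { now repeat split. }
  destruct (hrig G hfg) as [l [_ hl]]; auto.
  { left. exists N. split; auto. }
  (* [hl] yields cosets [G r], while [finite_index] asks for cosets [r G]; hence the inverses. *)
  exists (map ginv l). intro x.
  destruct (hl x^-1 I) as [h [r [c [hh [hr [hc E]]]]]].
  exists r^-1. split; [now apply in_map|].
  rewrite <- (ginvK _ x), E, hc. replace (r^-1^-1 ** (h ** r ** gone)^-1) with h^-1 by grp.
  now apply subV.
Qed.
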